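(* Let $F$ be a graph with $|F|=3$ and $e(F)>0$, let $\alpha,\beta>0$ with $\alpha+\beta<1$, and let $0<p\le1$. Then $\widetilde{\mathcal P}_{2,1}(F;\alpha,\beta)$ is a $p$-quasi-random property.
   Context: Label $V(F)=\{1,2,3\}$. For a graph $G$ and $U_1,U_2,U_3\subseteq V(G)$, $N(F,G;U_1,U_2,U_3)$ counts injective homomorphisms $\varphi:V(F)\to V(G)$ with $\varphi(i)\in U_i$, and $\widetilde N(F,G;U_1,U_2,U_3)$ is its average over all $6$ permutations of $(U_1,U_2,U_3)$; $N(H,G)$ counts injective homomorphisms $V(H)\to V(G)$. A sequence $(G_n)$, $|G_n|\to\infty$, is $p$-quasi-random if $N(H,G_n)=(p^{e(H)}+o(1))|G_n|^{|H|}$ for every graph $H$; a property of sequences is $p$-quasi-random if satisfied exactly by the $p$-quasi-random sequences. $\widetilde{\mathcal P}_{2,1}(F;\alpha,\beta)$ is the property: for all disjoint $U,U'\subseteq V(G_n)$ with $|U|=\lfloor\alpha|G_n|\rfloor$ and $|U'|=\lfloor\beta|G_n|\rfloor$, $\widetilde N(F,G_n;U,U,U')=p^{e(F)}|U|^2|U'|+o(|G_n|^3)$, uniformly in the subsets. *)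

(* Defs.v *)
From HB Require Import structures.
From mathcomp Require Import all_boot all_order all_algebra all_fingroup.
From mathcomp Require Import all_classical all_reals all_analysis.
Set Implicit Arguments.
Unset Strict Implicit.
Unset Printing Implicit Defensive.
Import Order.TTheory GRing.Theory Num.Theory.
Import numFieldNormedType.Exports.
Local Open Scope ring_scope.

Record sgraph := SGraph {
  vertex :> finType;
  adj : rel vertex;
  adj_sym : symmetric adj;
  adj_irrefl : irreflexive adj }.

Definition edges (H : sgraph) : {set {set H}} :=
  [set e : {set H} | [exists x, exists y, adj x y && (e == [set x; y]%SET)]]%SET.

Definition inj_homs (H G : sgraph) : {set {ffun H -> G}} :=
  [set f : {ffun H -> G} | injectiveb f &&
    [forall x, forall y, adj x y ==> adj (f x) (f y)]]%SET.

Definition nhom (H G : sgraph) : nat := #|inj_homs H G|.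

(* A labelling [v] of the vertices of [F] by 0, 1, 2 turns a triple
   (U_0, U_1, U_2) of vertex sets into constraints f (v i) \in U i. *)
Definition nhom3 (F G : sgraph) (v : 'I_3 -> F) (U : 'I_3 -> {set G}) : nat :=
  #|[set f in inj_homs F G | [forall i, f (v i) \in U i]]%SET|.

Definition triple (T : Type) (a b c : T) : 'I_3 -> T :=
  fun i => tnth [tuple a; b; c] i.

Section Properties.
Variable R : realType.

Definition avg_nhom3 (F G : sgraph) (v : 'I_3 -> F) (U : 'I_3 -> {set G}) : R :=
  6^-1 * \sum_(s : 'S_3) (nhom3 v (fun i => U (s i)))%:R.

Local Open Scope classical_set_scope.

Definition graph_property := (nat -> sgraph) -> Prop.

Definition order_to_infty : graph_property :=
  fun G => (fun n => #|G n|) @ \oo --> \oo.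

Definition quasi_random (p : R) : graph_property :=
  fun G => forall H : sgraph,
    (fun n => (nhom H (G n))%:R / #|G n|%:R ^+ #|H| : R) @ \oo
      --> p ^+ #|edges H|.

Definition quasi_random_property (p : R) (P : graph_property) : Prop :=
  forall G, order_to_infty G -> (P G <-> quasi_random p G).

(* The o(|G_n|^3) is uniform: the index from which the bound holds depends on
   [eps] only, not on [U] and [U']. *)
Definition P21 (F : sgraph) (v : 'I_3 -> F) (alpha beta p : R) :
    graph_property :=
  fun G => forall eps : R, 0 < eps -> \forall n \near \oo,
    forall U U' : {set G n}, [disjoint U & U']%B ->
      #|U|%:Z = Num.floor (alpha * #|G n|%:R) ->
      #|U'|%:Z = Num.floor (beta * #|G n|%:R) ->
      `| avg_nhom3 v (triple U U U')
         - p ^+ #|edges F| * #|U|%:R ^+ 2 * #|U'|%:R |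
        <= eps * #|G n|%:R ^+ 3.

End Properties.

(* Main.v *)
(* Both properties are equivalent to the discrepancy bound
   |e(X, Y) - p |X| |Y| | <= eps n^2 for all X, Y. That this bound gives all
   subgraph counts, also inside prescribed vertex sets, is the usual telescoping;
   that the counts of edges and 4-cycles give it back is two applications of
   Cauchy-Schwarz.

   Let f_A(x,y,z) be the symmetrised indicator of F and T the trilinear form of
   f_A - p^e. The hypothesis bounds T(U,U,U') for sets of the prescribed sizes;
   derandomised rounding extends it to weights s, t with s + t <= 1 and means
   alpha, beta. Perturbing the constant weights alpha, beta by functions of mean
   zero and comparing coefficients bounds T(X,Y,Z) for arbitrary sets. On a
   regular partition with average densities W this says that the sum of
   |f_W - p^e| over all triples is o(n^3).

   On four vertices the equations f_W = p^e force opposite edges to have equal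
   weights, in the robust form
   p^10 |W(x,y) - W(z,u)| <= 6 (sum of the errors of the four triples).
   Hence W is close to a constant, which must be p, and A has small
   discrepancy. *)
Require Import Defs.
From mathcomp Require Import all_boot all_order all_algebra all_fingroup.
From mathcomp Require Import all_classical all_reals all_analysis.
From mathcomp Require Import ring lra.
Set Implicit Arguments.
Unset Strict Implicit.
Unset Printing Implicit Defensive.
Import Order.TTheory GRing.Theory Num.Theory.
Import numFieldNormedType.Exports.
Local Open Scope ring_scope.

(** * A regularity lemma *)

Section Sums.
Variable R : realType.

(** The obstacle is that the hypothesis sees only disjoint pairs of two fixed sizes, with [U]
    filling two slots, while the regularity argument needs the form on triples of cells of any
    sizes, possibly equal. Fractional weights give the missing freedom: a perturbation of mean zero
    respects the prescribed sizes, and along it the form is a polynomial whose coefficients can be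
    isolated. Weights can be rounded vertex by vertex because the form vanishes on degenerate
    triples, hence is affine in the weights of each vertex; a quadratic penalty holds the sizes in
    place meanwhile.

    Two losses occur: a factor depending on [alpha] and [beta], and the cube of the number of cells.
    Both are known before the hypothesis is invoked, since regularity bounds the number of cells in
    terms of its accuracy alone.

    One triangle never determines its weights, so the rigidity must come from four faces together.
    The inequality obtained is linear in the errors and valid for any six numbers in the unit
    interval, so it is summed over all quadruples, degenerate ones included, with no exceptional set
    to discard. *)

Lemma eq_ler (x y : R) : x = y -> x <= y.
Proof. by move=> ->. Qed.

Lemma sum_sqr_le (I : finType) (f g : I -> R) :
  (\sum_i f i * g i) ^+ 2 <= (\sum_i f i ^+ 2) * (\sum_i g i ^+ 2).
Proof.
set a := \sum_i f i ^+ 2; set b := \sum_i g i ^+ 2; set c := \sum_i f i * g i.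
have quad (s t : R) : 0 <= s ^+ 2 * a - 2 * s * t * c + t ^+ 2 * b.
  have -> : s ^+ 2 * a - 2 * s * t * c + t ^+ 2 * b =
      \sum_i (s * f i - t * g i) ^+ 2.
    rewrite /a /b /c !mulr_sumr -sumrN -!big_split /=.
    by apply: eq_bigr => i _; ring.
  by apply: sumr_ge0 => i _; exact: sqr_ge0.
have a0 : 0 <= a by apply: sumr_ge0 => i _; exact: sqr_ge0.
have b0 : 0 <= b by apply: sumr_ge0 => i _; exact: sqr_ge0.
have [b1|bpos] := eqVneq b 0.
  have c0 : c = 0.
    rewrite /c big1 // => i _.
    have /eqP : b == 0 by rewrite b1.
    rewrite /b => /eqP; rewrite psumr_eq0 => [/allP|j _]; last exact: sqr_ge0.
    by move=> /(_ i); rewrite mem_index_enum sqrf_eq0 => /(_ isT)/eqP ->;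
      rewrite mulr0.
  by rewrite c0 b1 expr0n /= mulr0.
have {}bpos : 0 < b by rewrite lt_neqAle eq_sym bpos.
have := quad b c.
have -> : b ^+ 2 * a - 2 * b * c * c + c ^+ 2 * b = b * (a * b - c ^+ 2) by ring.
by rewrite pmulr_rge0 // subr_ge0.
Qed.

Lemma sum2_sqr_le (I J : finType) (f g : I -> J -> R) :
  (\sum_i \sum_j f i j * g i j) ^+ 2 <=
  (\sum_i \sum_j f i j ^+ 2) * (\sum_i \sum_j g i j ^+ 2).
Proof. by rewrite !pair_bigA /=; exact: sum_sqr_le. Qed.

Lemma sum_card1 (T : finType) : \sum_(x : T) (1 : R) = #|T|%:R.
Proof. by rewrite sumr_const. Qed.

Lemma sum_cells (T C : finType) (pi : T -> C) (F : T -> T -> R) :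
  \sum_x \sum_y F x y =
  \sum_i \sum_j \sum_(x | pi x == i) \sum_(y | pi y == j) F x y.
Proof.
rewrite (partition_big pi xpredT) //=; apply: eq_bigr => i _.
rewrite [RHS]exchange_big /=; apply: eq_bigr => x _.
by rewrite (partition_big pi xpredT).
Qed.

End Sums.

Section BlockAverage.
Variables (R : realType) (T C : finType) (pi : T -> C) (g : T -> T -> R).

Definition cell_size (i : C) : R := \sum_(x | pi x == i) 1.

Definition cell_sum (i j : C) : R :=
  \sum_(x | pi x == i) \sum_(y | pi y == j) g x y.

(** On an empty cell the quotient is a division by zero, hence [0]; [cell_avgE] holds there too,
    both sides being zero. *)
Definition cell_avg (i j : C) : R :=
  cell_sum i j / (cell_size i * cell_size j).

Definition block_avg (x y : T) : R := cell_avg (pi x) (pi y).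

Lemma cell_size_ge0 i : 0 <= cell_size i.
Proof. exact: sumr_ge0. Qed.

Lemma cell_size_eq0 i x : cell_size i = 0 -> pi x == i = false.
Proof.
move=> s0; apply/negP => pix; move/eqP: s0.
rewrite /cell_size psumr_eq0 // => /allP /(_ x).
by rewrite mem_index_enum pix /= oner_eq0 => /(_ isT).
Qed.

Lemma cell_avgE i j : cell_size i * cell_size j * cell_avg i j = cell_sum i j.
Proof.
rewrite /cell_avg; have [i0|i0] := eqVneq (cell_size i) 0.
  by rewrite i0 !mul0r /cell_sum big1 // => x; rewrite (cell_size_eq0 _ i0).
have [j0|j0] := eqVneq (cell_size j) 0.
  rewrite j0 mulr0 mul0r /cell_sum big1 // => x _.
  by rewrite big1 // => y; rewrite (cell_size_eq0 _ j0).
by rewrite mulrC mulfVK // mulf_neq0.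
Qed.

Lemma sum_cell_const i j (c : R) :
  \sum_(x | pi x == i) \sum_(y | pi y == j) c = cell_size i * cell_size j * c.
Proof.
rewrite /cell_size -mulrA mulr_suml; apply: eq_bigr => x _.
by rewrite mul1r mulr_suml; apply: eq_bigr => y _; rewrite mul1r.
Qed.

(** [block_avg] is the orthogonal projection of [g] onto the functions that are constant on products
    of cells: the residual sums to zero on each product. *)
Lemma block_avg_orth (h : C -> C -> R) :
  \sum_x \sum_y (g x y - block_avg x y) * h (pi x) (pi y) = 0.
Proof.
rewrite (sum_cells pi) big1 // => i _; rewrite big1 // => j _.
have -> : \sum_(x | pi x == i) \sum_(y | pi y == j)
    (g x y - block_avg x y) * h (pi x) (pi y) =
  (cell_sum i j - cell_size i * cell_size j * cell_avg i j) * h i j.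
  rewrite -sum_cell_const /cell_sum -sumrB mulr_suml.
  apply: eq_bigr => x /eqP pix; rewrite -sumrB mulr_suml.
  by apply: eq_bigr => y /eqP piy; rewrite /block_avg pix piy.
by rewrite cell_avgE subrr mul0r.
Qed.

Lemma block_avg_itv x y : (forall x y, 0 <= g x y <= 1) ->
  0 <= block_avg x y <= 1.
Proof.
move=> g01; rewrite /block_avg /cell_avg.
set i := pi x; set j := pi y.
have s0 : 0 <= cell_sum i j.
  by apply: sumr_ge0 => u _; apply: sumr_ge0 => w _; case/andP: (g01 u w).
have s1 : cell_sum i j <= cell_size i * cell_size j.
  rewrite -[leRHS]mulr1 -sum_cell_const.
  by apply: ler_sum => u _; apply: ler_sum => w _; case/andP: (g01 u w).
have p0 : 0 <= cell_size i * cell_size j by rewrite mulr_ge0 ?cell_size_ge0.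
have [->|pn0] := eqVneq (cell_size i * cell_size j) 0.
  by rewrite invr0 mulr0 lexx ler01.
have {}p0 : 0 < cell_size i * cell_size j by rewrite lt_neqAle eq_sym pn0.
by rewrite divr_ge0 ?(ltW p0) //= ler_pdivrMr // mul1r.
Qed.

End BlockAverage.

Section Regularity.
Variable R : realType.

(** An averaged form of Szemeredi regularity, with no equal cell sizes and no exceptional pairs. The
    absolute value stands inside the sum over pairs of cells, which is stronger than a cut norm
    bound and allows counting cell by cell. *)
Definition regular_partition (T C : finType) (pi : T -> C) (g : T -> T -> R)
    (eta : R) : Prop :=
  forall X Y : C -> C -> {set T},
  \sum_i \sum_j `|\sum_(x | pi x == i) \sum_(y | pi y == j)
     (g x y - block_avg pi g x y) * ((x \in X i j)%:R * (y \in Y i j)%:R)|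
  <= eta * #|T|%:R ^+ 2.

Definition energy (T C : finType) (pi : T -> C) (g : T -> T -> R) : R :=
  \sum_x \sum_y block_avg pi g x y ^+ 2.

Lemma energy_le (T C : finType) (pi : T -> C) (g : T -> T -> R) :
  (forall x y, 0 <= g x y <= 1) -> energy pi g <= #|T|%:R ^+ 2.
Proof.
move=> g01; rewrite expr2 -{1}sum_card1 mulr_suml.
apply: ler_sum => x _; rewrite mul1r -sum_card1; apply: ler_sum => y _.
by have /andP[b0 b1] := block_avg_itv pi x y g01; rewrite expr_le1.
Qed.

(** Pythagoras: the averages over [pi] are also constant on products of cells of the refinement
    [rho], so the increment of the averages is orthogonal to them. *)
Lemma energy_refine (T C D : finType) (pi : T -> C) (rho : T -> D)
    (r : D -> C) (g : T -> T -> R) : (forall x, r (rho x) = pi x) ->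
  energy rho g = energy pi g +
    \sum_x \sum_y (block_avg rho g x y - block_avg pi g x y) ^+ 2.
Proof.
move=> rE.
have o1 := block_avg_orth pi g (cell_avg pi g).
have o2 : \sum_x \sum_y (g x y - block_avg rho g x y) * block_avg pi g x y = 0.
  rewrite -[RHS](block_avg_orth rho g (fun i j => cell_avg pi g (r i) (r j))).
  by apply: eq_bigr => x _; apply: eq_bigr => y _; rewrite !rE.
have o3 : \sum_x \sum_y
    (block_avg rho g x y - block_avg pi g x y) * block_avg pi g x y = 0.
  transitivity (\sum_x \sum_y (g x y - block_avg pi g x y) * block_avg pi g x y
      - \sum_x \sum_y (g x y - block_avg rho g x y) * block_avg pi g x y).
    rewrite -sumrB; apply: eq_bigr => x _.
    by rewrite -sumrB; apply: eq_bigr => y _; ring.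
  by rewrite o1 o2 subrr.
transitivity (energy rho g - 2 * \sum_x \sum_y
    (block_avg rho g x y - block_avg pi g x y) * block_avg pi g x y).
  by rewrite o3 mulr0 subr0.
rewrite /energy mulr_sumr -sumrB -big_split /=.
apply: eq_bigr => x _; rewrite mulr_sumr -sumrB -big_split /=.
by apply: eq_bigr => y _; ring.
Qed.

(* Refine by all the witnesses of irregularity, and apply Cauchy-Schwarz to the
   change of the block averages against the signed indicator of the witnesses. *)
Lemma energy_increment (T C : finType) (pi : T -> C) (g : T -> T -> R)
    (eta : R) : 0 <= eta -> (0 < #|T|)%N -> ~ regular_partition pi g eta ->
  exists rho : T -> C * {ffun C * C -> bool * bool},
    energy pi g + eta ^+ 2 * #|T|%:R ^+ 2 <= energy rho g.
Proof.
move=> eta0 T0 /existsNP[X /existsNP[Y /negP]]; rewrite -ltNge => irr.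
pose rho (x : T) : C * {ffun C * C -> bool * bool} :=
  (pi x, [ffun ij => (x \in X ij.1 ij.2, x \in Y ij.1 ij.2)]).
exists rho; rewrite (energy_refine (pi := pi) (r := fst)) // lerD2l.
pose S i j := \sum_(x | pi x == i) \sum_(y | pi y == j)
     (g x y - block_avg pi g x y) * ((x \in X i j)%:R * (y \in Y i j)%:R).
pose h x y : R := Num.sg (S (pi x) (pi y)) *
  ((x \in X (pi x) (pi y))%:R * (y \in Y (pi x) (pi y))%:R).
have hE : \sum_i \sum_j `|S i j| =
    \sum_x \sum_y (g x y - block_avg pi g x y) * h x y.
  rewrite (sum_cells pi); apply: eq_bigr => i _; apply: eq_bigr => j _.
  rewrite normrEsg /S mulr_sumr; apply: eq_bigr => x /eqP pix.
  rewrite mulr_sumr; apply: eq_bigr => y /eqP piy.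
  by rewrite /h pix piy; ring.
(* [h] can be read off the labels of [rho], which store the witness bits; hence it is orthogonal to
   the residual of [rho]. *)
pose h' (i j : C * {ffun C * C -> bool * bool}) : R :=
  Num.sg (S i.1 j.1) * ((i.2 (i.1, j.1)).1%:R * (j.2 (i.1, j.1)).2%:R).
have o : \sum_x \sum_y (g x y - block_avg rho g x y) * h x y = 0.
  rewrite -[RHS](block_avg_orth rho g h').
  by apply: eq_bigr => x _; apply: eq_bigr => y _; rewrite /h' !ffunE.
have dE : \sum_i \sum_j `|S i j| =
    \sum_x \sum_y (block_avg rho g x y - block_avg pi g x y) * h x y.
  apply/eqP; rewrite hE -subr_eq0; apply/eqP; rewrite -[RHS]o -sumrB.
  by apply: eq_bigr => x _; rewrite -sumrB; apply: eq_bigr => y _; ring.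
have n0 : (0 : R) < #|T|%:R ^+ 2 by rewrite exprn_gt0 // ltr0n.
have hle : \sum_x \sum_y h x y ^+ 2 <= #|T|%:R ^+ 2.
  rewrite expr2 -{1}sum_card1 mulr_suml.
  apply: ler_sum => x _; rewrite mul1r -sum_card1; apply: ler_sum => y _.
  rewrite /h; case: (x \in _); case: (y \in _);
    rewrite /= ?(mul0r, mulr0, mulr1) ?expr0n /= ?ler01 //.
  by rewrite sqr_sg; case: (_ != 0).
have cs := sum2_sqr_le
  (fun x y => block_avg rho g x y - block_avg pi g x y) h.
rewrite -(ler_pM2r n0).
have -> : eta ^+ 2 * #|T|%:R ^+ 2 * #|T|%:R ^+ 2 = (eta * #|T|%:R ^+ 2) ^+ 2.
  by rewrite -mulrA -expr2 -exprMn.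
have D0 : 0 <= \sum_x \sum_y (block_avg rho g x y - block_avg pi g x y) ^+ 2.
  by apply: sumr_ge0 => x _; apply: sumr_ge0 => y _; exact: sqr_ge0.
apply: le_trans (ler_wpM2l D0 hle); apply: le_trans cs; rewrite -dE.
rewrite ler_pXn2r ?nnegrE ?mulr_ge0 ?(ltW n0) //; first exact: ltW.
by apply: sumr_ge0 => i _; apply: sumr_ge0 => j _.
Qed.

(** A refinement stores two bits per ordered pair of cells, so [k] cells become at most
    [k * 4 ^ (k ^ 2)]. *)
Fixpoint refine_bound (m : nat) : nat :=
  if m is m'.+1 then (refine_bound m' * 4 ^ (refine_bound m' ^ 2))%N else 1%N.

Lemma refine_bound_step m : (refine_bound m <= refine_bound m.+1)%N.
Proof. by rewrite /= leq_pmulr // expn_gt0. Qed.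

(** The energy never exceeds [n ^ 2] and every failure of regularity raises it by [eta ^ 2 * n ^ 2];
    [m] failures are impossible because [m] is strictly larger than [eta ^- 2]. *)
Lemma regularity (eta : R) : 0 < eta -> exists K : nat,
  forall (T : finType) (g : T -> T -> R), (0 < #|T|)%N ->
    (forall x y, 0 <= g x y <= 1) ->
  exists (C : finType) (pi : T -> C),
    (#|C| <= K)%N /\ regular_partition pi g eta.
Proof.
move=> eta0; pose m := Num.bound (eta ^- 2); exists (refine_bound m).
move=> T g T0 g01.
have n0 : (0 : R) < #|T|%:R ^+ 2 by rewrite exprn_gt0 // ltr0n.
have [//|noreg] := pselect (exists (C : finType) (pi : T -> C),
  (#|C| <= refine_bound m)%N /\ regular_partition pi g eta).
suff /(_ m (leqnn _)) [C [pi [_ en]]] : forall k, (k <= m)%N ->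
    exists (C : finType) (pi : T -> C), (#|C| <= refine_bound k)%N /\
      k%:R * eta ^+ 2 * #|T|%:R ^+ 2 <= energy pi g.
  have := le_trans en (energy_le pi g01).
  rewrite -[leRHS]mul1r ler_pM2r // -ler_pdivlMr ?exprn_gt0 // mul1r.
  by rewrite leNgt archi_boundP // invr_ge0 exprn_ge0 // ltW.
elim=> [|k IH] km.
  exists unit, (fun=> tt); rewrite card_unit; split=> //.
  by rewrite !mul0r; apply: sumr_ge0 => x _; apply: sumr_ge0 => y _;
    exact: sqr_ge0.
have [C [pi [cC en]]] := IH (ltnW km).
have nr : ~ regular_partition pi g eta.
  move=> reg; apply: noreg; exists C, pi; split=> //.
  apply: (leq_trans cC); have: (k <= m)%N by exact: ltnW.
  elim: {+}m => [|j IHj]; first by rewrite leqn0 => /eqP ->.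
  rewrite leq_eqVlt => /predU1P[->//|]; rewrite ltnS => /IHj /leq_trans.
  by apply; exact: refine_bound_step.
have [rho en'] := energy_increment (ltW eta0) T0 nr.
exists (C * {ffun C * C -> bool * bool})%type, rho; split.
  rewrite card_prod card_ffun !card_prod card_bool /=.
  by rewrite leq_mul // leq_exp2l // mulnn leq_sqr.
apply: le_trans en'; rewrite -natr1 !mulrDl mul1r; exact: lerD.
Qed.

End Regularity.

(** * Rounding fractional vertex weights *)

Section Trilinear.
Variables (R : realType) (T : finType).

Definition ind (U : {set T}) : T -> R := fun x => (x \in U)%:R.

Definition tri (tau : T -> T -> T -> R) (f g h : T -> R) : R :=
  \sum_x \sum_y \sum_z tau x y z * (f x * g y * h z).

(** Makes the trilinear form affine in the weights of each single vertex, since no monomial uses a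
    vertex twice. *)
Definition offdiag (tau : T -> T -> T -> R) : Prop :=
  forall x y, [/\ tau x x y = 0, tau x y x = 0 & tau y x x = 0].

(** Each vertex joins [U] with probability [s x], [U'] with probability [t x], and otherwise
    neither; the rounded sets are therefore disjoint. *)
Definition subdistr (s t : T -> R) : Prop :=
  forall x, [/\ 0 <= s x, 0 <= t x & s x + t x <= 1].

Definition integral_at (s t : T -> R) (x : T) : Prop :=
  [\/ s x = 1 /\ t x = 0, s x = 0 /\ t x = 1 | s x = 0 /\ t x = 0].

Definition upd (s : T -> R) (a : T) (r : R) : T -> R :=
  fun x => if x == a then r else s x.

Lemma sum_ind (U : {set T}) : \sum_x ind U x = #|U|%:R.
Proof.
by rewrite /ind -natr_sum -sum1_card [in RHS]big_mkcond.
Qed.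

Lemma ind_itv (U : {set T}) x : 0 <= ind U x <= 1.
Proof. by rewrite /ind; case: (x \in U); rewrite ?lexx ?ler01. Qed.

Lemma sum_upd s a r : \sum_x upd s a r x = \sum_x s x + (r - s a).
Proof.
rewrite (bigD1 a) //= [in RHS](bigD1 a) //= {1}/upd eqxx.
rewrite (eq_bigr s) => [|x /negbTE xa]; last by rewrite /upd xa.
by ring.
Qed.

Lemma tri_expand tau (f f' g g' h h' : T -> R) (a a' b b' c c' : R) :
  tri tau (fun x => a * f x + a' * f' x) (fun x => b * g x + b' * g' x)
      (fun x => c * h x + c' * h' x) =
  a * b * c * tri tau f g h + a * b * c' * tri tau f g h' +
  a * b' * c * tri tau f g' h + a * b' * c' * tri tau f g' h' +
  a' * b * c * tri tau f' g h + a' * b * c' * tri tau f' g h' +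
  a' * b' * c * tri tau f' g' h + a' * b' * c' * tri tau f' g' h'.
Proof.
rewrite /tri !mulr_sumr -!big_split /=; apply: eq_bigr => x _.
rewrite !mulr_sumr -!big_split /=; apply: eq_bigr => y _.
rewrite !mulr_sumr -!big_split /=; apply: eq_bigr => z _.
by ring.
Qed.

Lemma tri_opp tau f g h :
  tri (fun x y z => - tau x y z) f g h = - tri tau f g h.
Proof.
rewrite /tri -sumrN; apply: eq_bigr => x _; rewrite -sumrN.
by apply: eq_bigr => y _; rewrite -sumrN; apply: eq_bigr => z _; rewrite mulNr.
Qed.

Lemma tri_swap12 tau f g h : (forall x y z, tau x y z = tau y x z) ->
  tri tau f g h = tri tau g f h.
Proof.
move=> tC; rewrite /tri exchange_big /=; apply: eq_bigr => x _.
apply: eq_bigr => y _; apply: eq_bigr => z _; rewrite tC; ring.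
Qed.

Lemma tri_swap23 tau f g h : (forall x y z, tau x y z = tau x z y) ->
  tri tau f g h = tri tau f h g.
Proof.
move=> tC; rewrite /tri; apply: eq_bigr => x _; rewrite exchange_big /=.
apply: eq_bigr => y _; apply: eq_bigr => z _; rewrite tC; ring.
Qed.

Lemma tri_le tau f g h : (forall x y z, `|tau x y z| <= 1) ->
  `|tri tau f g h| <= (\sum_x `|f x|) * (\sum_x `|g x|) * (\sum_x `|h x|).
Proof.
move=> t1; rewrite /tri -mulrA mulr_suml.
apply: le_trans (ler_norm_sum _ _ _) _; apply: ler_sum => x _.
rewrite mulr_suml mulr_sumr.
apply: le_trans (ler_norm_sum _ _ _) _; apply: ler_sum => y _.
rewrite !mulr_sumr; apply: le_trans (ler_norm_sum _ _ _) _.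
apply: ler_sum => z _.
by rewrite !normrM -!mulrA -[leRHS]mul1r ler_wpM2r // !mulr_ge0.
Qed.

Lemma tri_diff_le tau f f1 h h1 (N : R) : (forall x y z, `|tau x y z| <= 1) ->
  \sum_x `|f x| <= N -> \sum_x `|f1 x| <= N -> \sum_x `|h x| <= N ->
  tri tau f f h - tri tau f1 f1 h1 <=
    N ^+ 2 * (2 * \sum_x `|f x - f1 x| + \sum_x `|h x - h1 x|).
Proof.
move=> t1 fN f1N hN.
have -> : tri tau f f h - tri tau f1 f1 h1 =
    tri tau (fun x => f x - f1 x) f h + tri tau f1 (fun x => f x - f1 x) h +
    tri tau f1 f1 (fun x => h x - h1 x).
  rewrite /tri -sumrB -!big_split /=; apply: eq_bigr => x _.
  rewrite -sumrB -!big_split /=; apply: eq_bigr => y _.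
  by rewrite -sumrB -!big_split /=; apply: eq_bigr => z _; ring.
have abs0 (k : T -> R) : 0 <= \sum_x `|k x| by apply: sumr_ge0.
have prod_le (A B : R) : 0 <= A <= N -> 0 <= B <= N -> A * B <= N ^+ 2.
  by move=> /andP[A0 AN] /andP[B0 BN]; rewrite expr2 ler_pM.
have e1 := le_trans (ler_norm _) (tri_le (fun x => f x - f1 x) f h t1).
have e2 := le_trans (ler_norm _) (tri_le f1 (fun x => f x - f1 x) h t1).
have e3 := le_trans (ler_norm _) (tri_le f1 f1 (fun x => h x - h1 x) t1).
apply: le_trans (lerD (lerD e1 e2) e3) _.
set df := \sum_x `|f x - f1 x|; set dh := \sum_x `|h x - h1 x|.
have -> : N ^+ 2 * (2 * df + dh) = df * N ^+ 2 + df * N ^+ 2 + N ^+ 2 * dh.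
  by ring.
apply: lerD; [apply: lerD|].
- by rewrite -mulrA ler_wpM2l ?abs0 // prod_le // ?abs0.
- by rewrite [_ * df]mulrC -mulrA ler_wpM2l ?abs0 // prod_le // ?abs0.
- by rewrite ler_wpM2r ?abs0 // prod_le // ?abs0.
Qed.

Lemma le_convex3 (c w1 w2 w3 P1 P2 P3 : R) :
  0 <= w1 -> 0 <= w2 -> 0 <= w3 -> w1 + w2 + w3 = 1 ->
  c <= w1 * P1 + w2 * P2 + w3 * P3 -> [\/ c <= P1, c <= P2 | c <= P3].
Proof.
move=> w10 w20 w30 w1E; set m := Num.max P1 (Num.max P2 P3).
have m1 : P1 <= m by rewrite /m !le_max lexx.
have m2 : P2 <= m by rewrite /m !le_max lexx orbT.
have m3 : P3 <= m by rewrite /m !le_max lexx !orbT.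
move=> cle; have : c <= m.
  apply: (le_trans cle); rewrite -[leRHS]mul1r -w1E !mulrDl.
  by rewrite !lerD // ler_wpM2l.
by rewrite /m !le_max => /orP[->|/orP[->|->]];
  [constructor 1|constructor 2|constructor 3].
Qed.

(** By [offdiag] the form is affine in the pair [(s a, t a)], and the three updates are the corners
    of the triangle of admissible pairs. *)
Lemma tri_upd_convex tau s t a : offdiag tau ->
  s a * tri tau (upd s a 1) (upd s a 1) (upd t a 0) +
  t a * tri tau (upd s a 0) (upd s a 0) (upd t a 1) +
  (1 - s a - t a) * tri tau (upd s a 0) (upd s a 0) (upd t a 0) =
  tri tau s s t.
Proof.
move=> off; rewrite /tri !mulr_sumr -!big_split /=; apply: eq_bigr => x _.
rewrite !mulr_sumr -!big_split /=; apply: eq_bigr => y _.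
rewrite !mulr_sumr -!big_split /=; apply: eq_bigr => z _.
have [ox1 ox2 ox3] := off a x.
have [oy1 oy2 oy3] := off a y.
have [oz1 oz2 oz3] := off a z.
have [oa _ _] := off a a.
rewrite /upd; have [->|xa] := eqVneq x a; have [->|ya] := eqVneq y a;
  have [->|za] := eqVneq z a; rewrite ?(oa, ox1, ox2, ox3, oy1, oy2, oy3, oz1, oz2, oz3);
  ring.
Qed.

(** Rounding must keep the form large and the sums near [a0] and [b0] at once; the penalty combines
    both demands in one quantity. *)
Definition potential tau (lam a0 b0 : R) (s t : T -> R) : R :=
  tri tau s s t - lam * ((\sum_x s x - a0) ^+ 2 + (\sum_x t x - b0) ^+ 2).

(* Conditional expectations: one of the three ways of rounding the weights of a
   vertex does not decrease the expected potential; the variance itg adds costs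
   at most [2 * lam]. *)
Lemma rounding_seq tau lam a0 b0 (l : seq T) : offdiag tau -> 0 <= lam ->
  forall s t, subdistr s t -> exists s' t' : T -> R, [/\ subdistr s' t',
    forall x, x \in l \/ integral_at s t x -> integral_at s' t' x &
    potential tau lam a0 b0 s t - 2 * lam * (size l)%:R <=
    potential tau lam a0 b0 s' t'].
Proof.
move=> off lam0; elim: l => [|a l IH] s t st.
  exists s, t; split=> //; last by rewrite mulr0 subr0.
  by move=> x [].
have [s0 t0 st1] := st a.
have step (u w : R) : [\/ u = 1 /\ w = 0, u = 0 /\ w = 1 | u = 0 /\ w = 0] ->
    potential tau lam a0 b0 s t - 2 * lam <=
      potential tau lam a0 b0 (upd s a u) (upd t a w) ->
    exists s' t' : T -> R, [/\ subdistr s' t',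
      forall x, x \in a :: l \/ integral_at s t x -> integral_at s' t' x &
      potential tau lam a0 b0 s t - 2 * lam * (size (a :: l))%:R <=
      potential tau lam a0 b0 s' t'].
  move=> uw le1.
  have [|s' [t' [fe itg le2]]] := IH (upd s a u) (upd t a w).
    move=> x; rewrite /upd; case: eqP => _; last exact: st.
    by case: uw => [] [-> ->]; rewrite ?addr0 ?add0r ?lexx ?ler01.
  exists s', t'; split=> // [x xal|].
    apply: itg; have [->|xa] := eqVneq x a.
      by right; rewrite /integral_at /upd eqxx.
    case: xal; first by rewrite inE (negbTE xa) /=; left.
    by right; rewrite /integral_at /upd (negbTE xa).
  apply: le_trans le2; rewrite /= -natr1; lra.
have := @le_convex3 (potential tau lam a0 b0 s t - 2 * lam)
  (s a) (t a) (1 - s a - t a)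
  (potential tau lam a0 b0 (upd s a 1) (upd t a 0))
  (potential tau lam a0 b0 (upd s a 0) (upd t a 1))
  (potential tau lam a0 b0 (upd s a 0) (upd t a 0)) s0 t0.
case.
- by rewrite -addrA -opprD subr_ge0.
- by ring.
- rewrite /potential !sum_upd -(tri_upd_convex s t a off).
  set Q1 := tri tau _ _ _; set Q2 := tri tau _ _ _; set Q3 := tri tau _ _ _.
  set D := \sum_x s x; set E := \sum_x t x.
  rewrite -subr_ge0; set q := (X in 0 <= X).
  (* The linear terms of the penalty cancel in the average; each square grows by the variance of a
     Bernoulli variable, which is at most [1]. *)
  have -> : q = lam * (2 - s a * (1 - s a) - t a * (1 - t a)).
    by rewrite /q; ring.
  by rewrite mulr_ge0 //; nra.
- by apply: step; constructor 1.
- by apply: step; constructor 2.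
- by apply: step; constructor 3.
Qed.

(** With the target sums taken from [s] and [t] the initial penalty is zero, so only the loss
    [2 * lam] per vertex remains. *)
Lemma rounding tau lam s t : offdiag tau -> 0 <= lam -> subdistr s t ->
  exists U U' : {set T}, [disjoint U & U']%B /\
    tri tau s s t - 2 * lam * #|T|%:R <=
    tri tau (ind U) (ind U) (ind U') -
    lam * ((#|U|%:R - \sum_x s x) ^+ 2 + (#|U'|%:R - \sum_x t x) ^+ 2).
Proof.
move=> off lam0 st.
have [s' [t' [fe itg]]] :=
  rounding_seq (\sum_x s x) (\sum_x t x) (enum T) off lam0 st.
rewrite -cardT {1}/potential !subrr expr0n /= addr0 mulr0 subr0 => le1.
have {}itg x : integral_at s' t' x by apply: itg; left; rewrite mem_enum.
pose U : {set T} := [set x | s' x == 1]%SET.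
pose U' : {set T} := [set x | t' x == 1]%SET.
have sU : s' = ind U.
  apply/funext => x; rewrite /ind inE; case: (itg x) => [] [-> _];
  by rewrite ?eqxx // eq_sym oner_eq0.
have tU : t' = ind U'.
  apply/funext => x; rewrite /ind inE; case: (itg x) => [] [_ ->];
  by rewrite ?eqxx // eq_sym oner_eq0.
exists U, U'; split; last by move: le1; rewrite /potential sU tU !sum_ind.
rewrite -setI_eq0; apply/eqP/setP => x; rewrite !inE.
by case: (itg x) => [] [-> ->]; rewrite ?eqxx eq_sym oner_eq0.
Qed.

Lemma subset_card_between (A B : {set T}) k : A \subset B ->
  (#|A| <= k <= #|B|)%N ->
  exists C : {set T}, [/\ A \subset C, C \subset B & #|C| = k].
Proof.
move=> AB /andP[Ak kB]; have [m mE] : exists m, m = (k - #|A|)%N by eexists.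
elim: m A AB Ak mE => [|m IH] A AB Ak mE.
  exists A; split=> //; apply/eqP; rewrite eqn_leq Ak.
  by rewrite -subn_eq0 -mE.
have Altk : (#|A| < k)%N by rewrite -subn_gt0 -mE.
have : A \proper B by rewrite properEcard AB (leq_trans Altk).
move=> /properP[_ [x xB xA]].
have cx : #|x |: A| = #|A|.+1 by rewrite cardsU1 xA.
have [|||C [xAC CB cC]] := IH (x |: A).
- by rewrite finset.subUset finset.sub1set xB.
- by rewrite cx.
- by rewrite cx subnS -mE.
exists C; split=> //; exact: fintype.subset_trans (finset.subsetUr _ _) xAC.
Qed.

Lemma sum_dist_ind (U V : {set T}) : U \subset V ->
  \sum_x `|ind U x - ind V x| = `|#|U|%:R - #|V|%:R|.
Proof.
move=> UV; rewrite -!sum_ind distrC -sumrB [RHS]ger0_norm; last first.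
  apply: sumr_ge0 => x _; rewrite subr_ge0 /ind ler_nat.
  by case xU: (x \in U) => //; rewrite (fintype.subsetP UV).
apply: eq_bigr => x _; rewrite distrC ger0_norm // subr_ge0 /ind ler_nat.
by case xU: (x \in U) => //; rewrite (fintype.subsetP UV).
Qed.

(** Cutting both oversized sets down makes room: [V] fits in the complement of the core of [U'],
    then [V'] in the complement of [V]. Each set is only shrunk or only enlarged, so the l1 distance
    equals the change of size. *)
Lemma resize (U U' : {set T}) a b : [disjoint U & U']%B -> (a + b <= #|T|)%N ->
  exists V V' : {set T}, [/\ [disjoint V & V']%B, #|V| = a, #|V'| = b,
    \sum_x `|ind U x - ind V x| = `|#|U|%:R - a%:R| &
    \sum_x `|ind U' x - ind V' x| = `|#|U'|%:R - b%:R|].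
Proof.
move=> dUU abn.
have core (A : {set T}) k : exists A0 : {set T},
    [/\ A0 \subset A, (#|A0| <= k)%N & #|A0| = k \/ A0 = A].
  have [Ak|kA] := leqP #|A| k; first by exists A; split=> //; right.
  have [||A0 [_ A0A cA0]] := @subset_card_between finset.set0 A k.
  - exact: finset.sub0set.
  - by rewrite cards0 /= ltnW.
  by exists A0; split=> //; [rewrite cA0 | left].
have [U0 [U0U cU0 U0E]] := core U a.
have [U1 [U1U cU1 U1E]] := core U' b.
have d01 : [disjoint U0 & U1]%B.
  exact: disjointWl U0U (disjointWr U1U dUU).
have [||V [U0V VU1 cV]] := @subset_card_between U0 (~: U1) a.
- by rewrite -finset.disjoints_subset.
- rewrite cU0 /= -(leq_add2l #|U1|) cardsC.
  by apply: leq_trans abn; rewrite addnC leq_add2l.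
have dV1 : U1 \subset ~: V by rewrite -finset.setCS finset.setCK.
have [|V' [U1V VV cV']] := @subset_card_between U1 (~: V) b dV1.
- by rewrite cU1 /= -(leq_add2l #|V|) cardsC cV.
exists V, V'; split=> //.
- by rewrite disjoint_sym finset.disjoints_subset.
- rewrite -cV; case: U0E => [c|E]; last by apply: sum_dist_ind; rewrite -E.
  have EV : U0 = V by apply/eqP; rewrite eqEcard U0V c cV leqnn.
  rewrite -EV distrC -(sum_dist_ind U0U).
  by apply: eq_bigr => x _; rewrite distrC.
- rewrite -cV'; case: U1E => [c|E]; last by apply: sum_dist_ind; rewrite -E.
  have EV : U1 = V' by apply/eqP; rewrite eqEcard U1V c cV' leqnn.
  rewrite -EV distrC -(sum_dist_ind U1U).
  by apply: eq_bigr => x _; rewrite distrC.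
Qed.

Lemma sum_abs_ind (U : {set T}) : \sum_x `|ind U x| <= #|T|%:R.
Proof.
rewrite (eq_bigr (ind U)) => [|x _]; first by rewrite sum_ind ler_nat max_card.
by rewrite ger0_norm //; case/andP: (ind_itv U x).
Qed.

Lemma fractional_le tau (s t : T -> R) a b (eps theta : R) :
  offdiag tau -> (forall x y z, `|tau x y z| <= 1) -> 0 < theta ->
  subdistr s t -> (0 < #|T|)%N -> (a + b <= #|T|)%N ->
  `|\sum_x s x - a%:R| <= 1 -> `|\sum_x t x - b%:R| <= 1 ->
  (forall U U' : {set T}, [disjoint U & U']%B -> #|U| = a -> #|U'| = b ->
    tri tau (ind U) (ind U) (ind U') <= eps) ->
  tri tau s s t <=
    eps + 2 * theta * #|T|%:R ^+ 3 + (3 + 2 / theta) * #|T|%:R ^+ 2.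
Proof.
move=> off t1 th0 st T0 abn sa tb bnd.
set n : R := #|T|%:R.
have n0 : 0 < n by rewrite ltr0n.
have lam0 : 0 <= theta * n ^+ 2 by rewrite mulr_ge0 ?exprn_ge0 // ltW.
have [U [U' [dU le1]]] := rounding off lam0 st.
have [V [V' [dV cV cV' dUV dUV']]] := resize dU abn.
have le2 := bnd V V' dV cV cV'.
have le3 := tri_diff_le (ind V') t1 (sum_abs_ind U) (sum_abs_ind V)
  (sum_abs_ind U').
rewrite dUV dUV' in le3; rewrite -/n in le1 le3.
set u := #|U|%:R - \sum_x s x in le1.
set u' := #|U'|%:R - \sum_x t x in le1.
have au : `|#|U|%:R - a%:R| <= `|u| + 1.
  apply: le_trans (lerD (lexx _) sa); rewrite -/u.
  by apply: le_trans (ler_normD _ _); rewrite /u addrA subrK.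
have au' : `|#|U'|%:R - b%:R| <= `|u'| + 1.
  apply: le_trans (lerD (lexx _) tb); rewrite -/u'.
  by apply: le_trans (ler_normD _ _); rewrite /u' addrA subrK.
have u2 : u ^+ 2 = `|u| ^+ 2 by rewrite real_normK // num_real.
have u2' : u' ^+ 2 = `|u'| ^+ 2 by rewrite real_normK // num_real.
rewrite u2 u2' in le1; move: `|u| `|u'| au au' le1 => w w' au au' le1.
have sq (k : R) : k - theta * k ^+ 2 <= theta^-1 / 4.
  rewrite -subr_ge0.
  have -> : theta^-1 / 4 - (k - theta * k ^+ 2) =
      theta * (k - theta^-1 / 2) ^+ 2.
    by field; rewrite gt_eqF.
  by rewrite mulr_ge0 ?sqr_ge0 // ltW.
have sq1 := sq w'.
have sq2 : 2 * w - theta * w ^+ 2 <= theta^-1.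
  rewrite -subr_ge0.
  have -> : theta^-1 - (2 * w - theta * w ^+ 2) = theta * (w - theta^-1) ^+ 2.
    by field; rewrite gt_eqF.
  by rewrite mulr_ge0 ?sqr_ge0 // ltW.
have n20 : 0 <= n ^+ 2 by rewrite exprn_ge0 // ltW.
have thi : 0 < theta^-1 by rewrite invr_gt0.
have key : n ^+ 2 * (2 * (w + 1) + (w' + 1)) -
    theta * n ^+ 2 * (w ^+ 2 + w' ^+ 2) <= n ^+ 2 * (3 + 2 / theta).
  have -> : n ^+ 2 * (2 * (w + 1) + (w' + 1)) -
      theta * n ^+ 2 * (w ^+ 2 + w' ^+ 2) =
    n ^+ 2 * (3 + (2 * w - theta * w ^+ 2) + (w' - theta * w' ^+ 2)) by ring.
  rewrite ler_wpM2l //; lra.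
have le4 : n ^+ 2 * (2 * `|#|U|%:R - a%:R| + `|#|U'|%:R - b%:R|) <=
    n ^+ 2 * (2 * (w + 1) + (w' + 1)).
  by rewrite ler_wpM2l //; lra.
have -> : 2 * theta * n ^+ 3 = 2 * (theta * n ^+ 2) * n by ring.
rewrite [(3 + _) * _]mulrC; lra.
Qed.

Lemma fractional_norm_le tau (s t : T -> R) a b (eps theta : R) :
  offdiag tau -> (forall x y z, `|tau x y z| <= 1) -> 0 < theta ->
  subdistr s t -> (0 < #|T|)%N -> (a + b <= #|T|)%N ->
  `|\sum_x s x - a%:R| <= 1 -> `|\sum_x t x - b%:R| <= 1 ->
  (forall U U' : {set T}, [disjoint U & U']%B -> #|U| = a -> #|U'| = b ->
    `|tri tau (ind U) (ind U) (ind U')| <= eps) ->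
  `|tri tau s s t| <=
    eps + 2 * theta * #|T|%:R ^+ 3 + (3 + 2 / theta) * #|T|%:R ^+ 2.
Proof.
move=> off t1 th0 st T0 abn sa tb bnd.
rewrite ler_norml lerNl -tri_opp; apply/andP; split;
  apply: (@fractional_le _ _ _ a b) => //.
- by move=> x y; have [e1 e2 e3] := off x y; rewrite e1 e2 e3 oppr0.
- by move=> x y z; rewrite normrN.
- move=> U U' dU cU cU'; rewrite tri_opp.
  by apply: le_trans (bnd U U' dU cU cU'); rewrite -normrN ler_norm.
- move=> U U' dU cU cU'.
  by apply: le_trans (bnd U U' dU cU cU'); rewrite ler_norm.
Qed.

End Trilinear.

(** * Recovering a trilinear form from its restriction *)

Section Polarization.
Variables (R : realType) (T : finType) (tau : T -> T -> T -> R).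
Variables (alpha beta M : R).
Hypothesis alpha0 : 0 < alpha.
Hypothesis beta0 : 0 < beta.
Hypothesis alphabeta1 : alpha + beta < 1.
Hypothesis T0 : (0 < #|T|)%N.
Hypothesis tauC12 : forall x y z, tau x y z = tau y x z.
Hypothesis tauC23 : forall x y z, tau x y z = tau x z y.
Hypothesis tri_small : forall s t : T -> R, subdistr s t ->
  \sum_x s x = alpha * #|T|%:R -> \sum_x t x = beta * #|T|%:R ->
  `|tri tau s s t| <= M.

(** How far both constant weights can be moved simultaneously: [a] and [b] keep them nonnegative,
    and the half is there because both may grow at the same vertex. *)
Definition margin (a b : R) : R := Num.min a (Num.min b ((1 - a - b) / 2)).

Let kappa := margin alpha beta.
Let one : T -> R := fun=> 1.
Let t3 := tri tau.

Definition balanced (k : R) (d : T -> R) : Prop :=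
  (forall x, `|d x| <= k) /\ \sum_x d x = 0.

Lemma margin_gt0 : 0 < kappa.
Proof. by rewrite /kappa /margin !lt_min alpha0 beta0 /= divr_gt0 // -addrA
  -opprD subr_gt0. Qed.

Lemma margin_le : [/\ kappa <= alpha, kappa <= beta &
  kappa <= (1 - alpha - beta) / 2].
Proof. by rewrite /kappa /margin !ge_min !lexx !orbT. Qed.

(** The perturbed weights stay admissible with unchanged means. The form is then quadratic in [th]
    and affine in [ph], and signed combinations of its values at [0], [1] and [-1] isolate the
    coefficients. *)
Lemma tri_perturb (d e : T -> R) (th ph : R) :
  balanced kappa d -> balanced kappa e -> `|th| <= 1 -> `|ph| <= 1 ->
  `|alpha ^+ 2 * beta * t3 one one one + 2 * alpha * beta * th * t3 d one one
    + beta * th ^+ 2 * t3 d d one + ph * (alpha ^+ 2 * t3 one one e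
    + 2 * alpha * th * t3 d one e + th ^+ 2 * t3 d d e)| <= M.
Proof.
move=> [dk d0] [ek e0] th1 ph1.
have [ka kb kc] := margin_le.
have small (r : R) (k : T -> R) x :
    `|r| <= 1 -> `|k x| <= kappa -> - kappa <= r * k x <= kappa.
  move=> r1 kk; rewrite -ler_norml normrM.
  by apply: le_trans kk; rewrite ler_piMl.
have := @tri_small (fun x => alpha * one x + th * d x)
  (fun x => beta * one x + ph * e x).
have sum_pert (a r : R) (k : T -> R) : \sum_x k x = 0 ->
    \sum_x (a * one x + r * k x) = a * #|T|%:R.
  by move=> k0; rewrite big_split /= -!mulr_sumr k0 mulr0 addr0 sum_card1.
rewrite !sum_pert // => /(_ _ erefl erefl).
rewrite tri_expand -/t3 => H.
have -> : alpha ^+ 2 * beta * t3 one one one + 2 * alpha * beta * th * t3 d one one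
    + beta * th ^+ 2 * t3 d d one + ph * (alpha ^+ 2 * t3 one one e
    + 2 * alpha * th * t3 d one e + th ^+ 2 * t3 d d e) =
  alpha * alpha * beta * t3 one one one + alpha * alpha * ph * t3 one one e +
  alpha * th * beta * t3 one d one + alpha * th * ph * t3 one d e +
  th * alpha * beta * t3 d one one + th * alpha * ph * t3 d one e +
  th * th * beta * t3 d d one + th * th * ph * t3 d d e.
  have -> : t3 one d one = t3 d one one by exact: tri_swap12.
  have -> : t3 one d e = t3 d one e by exact: tri_swap12.
  by ring.
apply: H => x.
have /andP[d1 d2] := small th d x th1 (dk x).
have /andP[e1 e2] := small ph e x ph1 (ek x).
by rewrite /one; split; lra.
Qed.

Lemma tri_const_le : alpha ^+ 2 * beta * `|t3 one one one| <= M.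
Proof.
have b0 : balanced kappa (fun=> 0).
  split=> [x|]; first by rewrite normr0 ltW // margin_gt0.
  by rewrite big1.
have := tri_perturb (th := 0) (ph := 0) b0 b0.
rewrite normr0 => /(_ ler01 ler01).
rewrite expr0n /= !(mulr0, mul0r, addr0) normrM ger0_norm //.
by rewrite mulr_ge0 ?exprn_ge0 // ltW.
Qed.

Lemma tri_deg1_le e : balanced kappa e ->
  alpha ^+ 2 * `|t3 one one e| <= M.
Proof.
move=> be.
have b0 : balanced kappa (fun=> 0).
  split=> [x|]; first by rewrite normr0 ltW // margin_gt0.
  by rewrite big1.
have n0 : `|0 : R| <= 1 by rewrite normr0 ler01.
have n1 : `|1 : R| <= 1 by rewrite normr1.
have nm1 : `|-1 : R| <= 1 by rewrite normrN1.
have e1 := tri_perturb b0 be n0 n1; have e2 := tri_perturb b0 be n0 nm1.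
rewrite -[alpha ^+ 2]ger0_norm ?exprn_ge0 ?(ltW alpha0) // -normrM.
move: e1 e2; rewrite expr0n /= !(mulr0, mul0r, addr0) mul1r mulN1r.
rewrite !ler_norml => /andP[a1 a2] /andP[a3 a4]; apply/andP; split; lra.
Qed.

Lemma tri_deg2_le d e : balanced kappa d -> balanced kappa e ->
  2 * alpha * `|t3 d one e| <= M.
Proof.
move=> bd be.
have n1 : `|1 : R| <= 1 by rewrite normr1.
have nm1 : `|-1 : R| <= 1 by rewrite normrN1.
have e1 := tri_perturb bd be n1 n1; have e2 := tri_perturb bd be n1 nm1.
have e3 := tri_perturb bd be nm1 n1; have e4 := tri_perturb bd be nm1 nm1.
rewrite -[2 * alpha]ger0_norm ?mulr_ge0 ?(ltW alpha0) // -normrM.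
move: e1 e2 e3 e4; rewrite sqrrN expr1n !(mulr1, mul1r, mulN1r, mulrN1).
rewrite !ler_norml => /andP[a1 a2] /andP[a3 a4] /andP[a5 a6] /andP[a7 a8].
by apply/andP; split; lra.
Qed.

(** The part even in [th] and odd in [ph] is [alpha ^ 2 * t3 one one e + t3 d d e]. It is at most
    [M] in absolute value, and so is its first summand by [tri_deg1_le]. *)
Lemma tri_deg3_le d e : balanced kappa d -> balanced kappa e ->
  `|t3 d d e| <= 2 * M.
Proof.
move=> bd be.
have n1 : `|1 : R| <= 1 by rewrite normr1.
have nm1 : `|-1 : R| <= 1 by rewrite normrN1.
have e1 := tri_perturb bd be n1 n1; have e2 := tri_perturb bd be n1 nm1.
have e3 := tri_perturb bd be nm1 n1; have e4 := tri_perturb bd be nm1 nm1.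
have := tri_deg1_le be.
rewrite -[alpha ^+ 2]ger0_norm ?exprn_ge0 ?(ltW alpha0) // -normrM.
move: e1 e2 e3 e4; rewrite sqrrN expr1n !(mulr1, mul1r, mulN1r, mulrN1).
rewrite !ler_norml => /andP[a1 a2] /andP[a3 a4] /andP[a5 a6] /andP[a7 a8].
by move=> /andP[a9 a10]; apply/andP; split; lra.
Qed.

(** Polarization: the values at [d + d'] and [d - d'] differ by [4 * t3 d d' e]. The halved margin
    keeps these two functions within [kappa]. *)
Lemma tri_polar_le d d' e : balanced (kappa / 2) d -> balanced (kappa / 2) d' ->
  balanced (kappa / 2) e -> `|t3 d d' e| <= M.
Proof.
move=> [dk d0] [dk' d0'] [ek e0].
have k0 := margin_gt0.
have be : balanced kappa e.
  by split=> // x; apply: le_trans (ek x) _; lra.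
have comb (r : R) : `|r| = 1 -> balanced kappa (fun x => 1 * d x + r * d' x).
  move=> r1; split=> [x|].
    apply: le_trans (ler_normD _ _) _; rewrite !normrM normr1 r1 !mul1r.
    by have := dk x; have := dk' x; lra.
  by rewrite big_split /= -!mulr_sumr d0 d0' !mulr0 addr0.
have expand r : t3 (fun x => 1 * d x + r * d' x)
    (fun x => 1 * d x + r * d' x) e =
    t3 d d e + 2 * r * t3 d d' e + r ^+ 2 * t3 d' d' e.
  have -> : t3 (fun x => 1 * d x + r * d' x) (fun x => 1 * d x + r * d' x) e =
      t3 (fun x => 1 * d x + r * d' x) (fun x => 1 * d x + r * d' x)
        (fun x => 1 * e x + 0 * e x).
    by congr t3; apply/funext => x; ring.
  rewrite /t3 tri_expand -/t3.
  have -> : t3 d' d e = t3 d d' e by exact: tri_swap12.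
  by ring.
have := tri_deg3_le (comb 1 (normr1 _)) be.
have := tri_deg3_le (comb (-1) (normrN1 _)) be.
rewrite !expand sqrrN expr1n !(mulr1, mul1r, mulrN1).
rewrite !ler_norml => /andP[a1 a2] /andP[a3 a4]; apply/andP; split; lra.
Qed.

(** The summands bound the terms with zero, one, two and three balanced factors. Each balanced
    factor costs [2 / margin a b], the scaling needed to fit a centred indicator into half the
    margin. *)
Definition polar_const (a b : R) : R :=
  (a ^+ 2 * b)^-1 + 3 * (2 / margin a b) * (a ^+ 2)^-1 +
  3 * (2 / margin a b) ^+ 2 * (2 * a)^-1 + (2 / margin a b) ^+ 3.

(* Write [ind A] as its mean plus a balanced function and expand. *)
Lemma tri_ind_le (A B C : {set T}) :
  `|t3 (ind R A) (ind R B) (ind R C)| <= polar_const alpha beta * M.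
Proof.
have k0 := margin_gt0.
set n : R := #|T|%:R; have n0 : 0 < n by rewrite ltr0n.
pose mu (U : {set T}) : R := #|U|%:R / n.
pose d (U : {set T}) x : R := kappa / 2 * (ind R U x - mu U).
have mu01 U : 0 <= mu U <= 1.
  by rewrite /mu divr_ge0 ?(ltW n0) //= ler_pdivrMr // mul1r ler_nat max_card.
have bd U : balanced (kappa / 2) (d U).
  split=> [x|].
    rewrite /d normrM ger0_norm; last by rewrite divr_ge0 // ltW.
    rewrite ler_piMr ?divr_ge0 ?(ltW k0) // ler_norml.
    have /andP[i0 i1] := ind_itv R U x; have /andP[m0 m1] := mu01 U.
    by apply/andP; split; lra.
  have sm : \sum_(x : T) mu U = mu U * n by rewrite sumr_const mulr_natr.
  rewrite /d -mulr_sumr sumrB sum_ind sm /mu.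
  by rewrite divfK ?subrr ?mulr0 // gt_eqF.
have bd' U : balanced kappa (d U).
  by have [h1 h2] := bd U; split=> // x; apply: le_trans (h1 x) _; lra.
set k := 2 / kappa.
have kpos : 0 < k by rewrite divr_gt0.
have indE U : ind R U = (fun x => mu U * one x + k * d U x).
  apply/funext => x; rewrite /one /d /k; field; rewrite gt_eqF //.
rewrite [ind R A]indE [ind R B]indE [ind R C]indE /t3 tri_expand -/t3.
have -> : t3 one (d B) one = t3 one one (d B) by exact: tri_swap23.
have -> : t3 one (d B) (d C) = t3 (d B) one (d C) by exact: tri_swap12.
have -> : t3 (d A) one one = t3 one one (d A).
  by rewrite [LHS]tri_swap12 // tri_swap23.
have -> : t3 (d A) (d B) one = t3 (d A) one (d B) by exact: tri_swap23.
have a20 : 0 < alpha ^+ 2 by rewrite exprn_gt0.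
have c0 : `|t3 one one one| <= (alpha ^+ 2 * beta)^-1 * M.
  by rewrite mulrC ler_pdivlMr ?mulr_gt0 // mulrC; exact: tri_const_le.
have c1 U : `|t3 one one (d U)| <= (alpha ^+ 2)^-1 * M.
  by rewrite mulrC ler_pdivlMr // mulrC; exact: tri_deg1_le.
have c2 U V : `|t3 (d U) one (d V)| <= (2 * alpha)^-1 * M.
  by rewrite mulrC ler_pdivlMr ?mulr_gt0 // mulrC; exact: tri_deg2_le.
have c3 : `|t3 (d A) (d B) (d C)| <= M by exact: tri_polar_le.
have coef (m b c q : R) : 0 <= m <= 1 -> 0 <= b -> `|c| <= q ->
    `|m * b * c| <= b * q.
  move=> /andP[m0 m1] b0 cq; rewrite -mulrA normrM (ger0_norm m0).
  apply: le_trans (_ : 1 * `|b * c| <= _); first by rewrite ler_wpM2r.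
  by rewrite mul1r normrM (ger0_norm b0) ler_wpM2l.
have mu2 U V : 0 <= mu U * mu V <= 1.
  have /andP[? ?] := mu01 U; have /andP[? ?] := mu01 V.
  by rewrite mulr_ge0 // mulr_ile1.
have mu3 U V W : 0 <= mu U * mu V * mu W <= 1.
  have /andP[? ?] := mu2 U V; have /andP[? ?] := mu01 W.
  by rewrite mulr_ge0 // mulr_ile1.
have i1 : 0 <= (1 : R) <= 1 by rewrite ler01 lexx.
have k2 : 0 <= k ^+ 2 by rewrite exprn_ge0 // ltW.
have k3 : 0 <= k ^+ 3 by rewrite exprn_ge0 // ltW.
have -> : mu A * mu B * mu C * t3 one one one +
  mu A * mu B * k * t3 one one (d C) + mu A * k * mu C * t3 one one (d B) +
  mu A * k * k * t3 (d B) one (d C) + k * mu B * mu C * t3 one one (d A) +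
  k * mu B * k * t3 (d A) one (d C) + k * k * mu C * t3 (d A) one (d B) +
  k * k * k * t3 (d A) (d B) (d C) =
  mu A * mu B * mu C * 1 * t3 one one one +
  (mu A * mu B * k * t3 one one (d C) + mu A * mu C * k * t3 one one (d B) +
  mu B * mu C * k * t3 one one (d A)) + (mu A * k ^+ 2 * t3 (d B) one (d C) +
  mu B * k ^+ 2 * t3 (d A) one (d C) + mu C * k ^+ 2 * t3 (d A) one (d B)) +
  1 * k ^+ 3 * t3 (d A) (d B) (d C) by ring.
have -> : polar_const alpha beta * M =
  1 * ((alpha ^+ 2 * beta)^-1 * M) +
  (k * ((alpha ^+ 2)^-1 * M) + k * ((alpha ^+ 2)^-1 * M) +
  k * ((alpha ^+ 2)^-1 * M)) + (k ^+ 2 * ((2 * alpha)^-1 * M) +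
  k ^+ 2 * ((2 * alpha)^-1 * M) + k ^+ 2 * ((2 * alpha)^-1 * M)) + k ^+ 3 * M.
  by rewrite /polar_const -/kappa -/k; ring.
have add (a b A' B' : R) : `|a| <= A' -> `|b| <= B' -> `|a + b| <= A' + B'.
  by move=> ? ?; apply: le_trans (ler_normD _ _) _; exact: lerD.
have kge := ltW kpos.
apply: (add); last exact: coef.
apply: (add); last by apply: (add); [apply: (add)|]; exact: coef.
apply: (add); first exact: coef.
by apply: (add); [apply: (add)|]; exact: coef.
Qed.

End Polarization.

(** * Stability of the pointwise equation *)

Section Pointwise.
Variable R : realType.

(* The symmetrised edge polynomial of a graph with 3 vertices and [e] edges. *)
Definition tri_poly (e : nat) (a b c : R) : R :=
  match e with
  | 1%N => (a + b + c) / 3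
  | 2%N => (a * b + a * c + b * c) / 3
  | _ => a * b * c
  end.

Lemma tri_polyC12 e a b c : tri_poly e a b c = tri_poly e b a c.
Proof. by case: e => [|[|[|e]]] /=; ring. Qed.

Lemma tri_polyC23 e a b c : tri_poly e a b c = tri_poly e a c b.
Proof. by case: e => [|[|[|e]]] /=; ring. Qed.

Lemma tri_poly_itv e a b c : 0 <= a <= 1 -> 0 <= b <= 1 -> 0 <= c <= 1 ->
  0 <= tri_poly e a b c <= 1.
Proof.
move=> /andP[a0 a1] /andP[b0 b1] /andP[c0 c1].
have ab0 : 0 <= a * b by rewrite mulr_ge0.
have ac0 : 0 <= a * c by rewrite mulr_ge0.
have bc0 : 0 <= b * c by rewrite mulr_ge0.
have ab1 : a * b <= 1 by rewrite mulr_ile1.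
have ac1 : a * c <= 1 by rewrite mulr_ile1.
have bc1 : b * c <= 1 by rewrite mulr_ile1.
case: e => [|[|[|e]]] /=.
- by rewrite mulr_ge0 // mulr_ile1.
- by apply/andP; split; lra.
- by apply/andP; split; lra.
- by rewrite mulr_ge0 // mulr_ile1.
Qed.

Lemma norm_mul_le (x y A B : R) : `|x| <= A -> `|y| <= B -> `|x * y| <= A * B.
Proof. by move=> xA yB; rewrite normrM ler_pM. Qed.

Lemma norm_add_le (x y A B : R) : `|x| <= A -> `|y| <= B -> `|x + y| <= A + B.
Proof. by move=> xA yB; apply: le_trans (ler_normD _ _) _; exact: lerD. Qed.

Lemma norm_sub_le (x y A B : R) : `|x| <= A -> `|y| <= B -> `|x - y| <= A + B.
Proof. by move=> xA yB; apply: norm_add_le => //; rewrite normrN. Qed.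

Lemma norm_itv_le1 (x : R) : 0 <= x <= 1 -> `|x| <= 1.
Proof. by case/andP=> x0 x1; rewrite ger0_norm. Qed.

(* With [s^2 = k] and [ab + ac + bc = k], the product
   [(a + is)(b + is)(c + is)] is real; multiplying this for two faces of a
   tetrahedron with the conjugates for the other two faces leaves
   [(x + is)^2 (x' - is)^2] times a positive factor, where [x], [x'] are the
   weights of opposite edges. *)
Lemma opposite_edges_cherry (p a a' b b' c c' : R) (f := tri_poly 2) :
  0 < p <= 1 -> 0 <= a <= 1 -> 0 <= a' <= 1 -> 0 <= b <= 1 -> 0 <= b' <= 1 ->
  0 <= c <= 1 -> 0 <= c' <= 1 ->
  p ^+ 10 * `|a - a'| <= 6 * (`|f a b c' - p ^+ 2| + `|f a c b' - p ^+ 2| +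
    `|f b c a' - p ^+ 2| + `|f c' b' a' - p ^+ 2|).
Proof.
move=> /andP[p0 p1] a01 a01' b01 b01' c01 c01'.
have [k kE] : exists k : R, k = 3 * p ^+ 2 by exists (3 * p ^+ 2).
(* [re x y z] and [s * eps x y z] are the real and imaginary parts of [(x + is) (y + is) (z + is)];
   the choice of [k] makes [eps] three times the error of [f]. *)
pose eps (x y z : R) := x * y + x * z + y * z - k.
pose re (x y z : R) := x * y * z - k * (x + y + z).
have epsE x y z : eps x y z = 3 * (f x y z - p ^+ 2).
  by rewrite /eps /f kE /=; field.
have k0 : 0 <= k by rewrite kE mulr_ge0 // exprn_ge0 // ltW.
have k3 : k <= 3 by rewrite kE ler_piMr // exprn_ile1 // ltW.
have re_le x y z : 0 <= x <= 1 -> 0 <= y <= 1 -> 0 <= z <= 1 ->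
    `|re x y z| <= 9.
  move=> x01 y01 z01.
  have /andP[m0 m1] : 0 <= x * y * z <= 1.
    exact: (@tri_poly_itv 3).
  have {x01 y01 z01} s3 : 0 <= x + y + z <= 3.
    by move: x01 y01 z01 => /andP[? ?] /andP[? ?] /andP[? ?];
      apply/andP; split; lra.
  have /andP[s0 s1] := s3.
  have q9 : k * (x + y + z) <= 3 * 3 by rewrite ler_pM.
  have q0 : 0 <= k * (x + y + z) by rewrite mulr_ge0.
  by rewrite /re ler_norml; apply/andP; split; lra.
have eps_le x y z : 0 <= x <= 1 -> 0 <= y <= 1 -> 0 <= z <= 1 ->
    `|eps x y z| <= 3.
  move=> x01 y01 z01.
  have /andP[f0 f1] := tri_poly_itv 2 x01 y01 z01.
  rewrite epsE normrM ger0_norm // ler_piMr // ler_norml -/(f x y z).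
  have p20 : 0 <= p ^+ 2 by rewrite exprn_ge0 // ltW.
  have p21 : p ^+ 2 <= 1 by rewrite exprn_ile1 // ltW.
  by rewrite /f; apply/andP; split; lra.
set e1 := eps a b c'; set e2 := eps a c b'; set e3 := eps b c a'.
set e4 := eps c' b' a'.
pose r1 := re a b c'; pose r2 := re a c b'; pose r3 := re b c a'.
pose r4 := re c' b' a'.
have [N NE] : exists N : R,
    N = (b ^+ 2 + k) * (b' ^+ 2 + k) * (c ^+ 2 + k) * (c' ^+ 2 + k).
  by eexists.
(* The imaginary part, divided by [s], of the product of two faces with the conjugates of the other
   two. *)
have idt : (r1 * e2 + r2 * e1) * (r3 * r4 - k * e3 * e4) -
    (r3 * e4 + r4 * e3) * (r1 * r2 - k * e1 * e2) =
    2 * (a * a' + k) * (a' - a) * N.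
  by rewrite /e1 /e2 /e3 /e4 /r1 /r2 /r3 /r4 NE /eps /re; ring.
have Pbound (x y u v : R) : `|x| <= 9 -> `|y| <= 9 -> `|u| <= 3 -> `|v| <= 3 ->
    `|x * y - k * u * v| <= 108.
  move=> x9 y9 u3 v3.
  have -> : (108 : R) = 9 * 9 + 3 * 3 * 3 by ring.
  apply: norm_sub_le; first exact: norm_mul_le.
  by apply: norm_mul_le => //; apply: norm_mul_le => //; rewrite ger0_norm.
have Sbound (x y u v : R) : `|x| <= 9 -> `|y| <= 9 ->
    `|x * v + y * u| <= 9 * `|v| + 9 * `|u|.
  by move=> x9 y9; apply: norm_add_le; apply: norm_mul_le.
have lhs : `|2 * (a * a' + k) * (a' - a) * N| <=
    (9 * `|e2| + 9 * `|e1|) * 108 + (9 * `|e4| + 9 * `|e3|) * 108.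
  rewrite -idt; apply: norm_sub_le; apply: norm_mul_le.
  - by apply: Sbound; exact: re_le.
  - by apply: Pbound; do ?exact: re_le; exact: eps_le.
  - by apply: Sbound; exact: re_le.
  - by apply: Pbound; do ?exact: re_le; exact: eps_le.
have N_ge : k ^+ 4 <= N.
  have h x : k <= x ^+ 2 + k by rewrite lerDr sqr_ge0.
  have -> : k ^+ 4 = k * k * k * k by ring.
  rewrite NE; apply: (@ler_pM R) => //; first by rewrite !mulr_ge0.
  apply: (@ler_pM R) => //; first by rewrite mulr_ge0.
  exact: ler_pM.
have rhs : 2 * k ^+ 5 * `|a - a'| <= `|2 * (a * a' + k) * (a' - a) * N|.
  rewrite !normrM (ger0_norm (ler0n _ 2)) distrC.
  have aa0 : 0 <= a * a'.
    by case/andP: a01 => ? _; case/andP: a01' => ? _; rewrite mulr_ge0.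
  have k40 : 0 <= k ^+ 4 by rewrite exprn_ge0.
  rewrite (ger0_norm (le_trans k40 N_ge)) ger0_norm ?addr_ge0 //.
  have -> : 2 * k ^+ 5 * `|a' - a| = 2 * `|a' - a| * (k * k ^+ 4) by ring.
  have -> : 2 * (a * a' + k) * `|a' - a| * N =
    2 * `|a' - a| * ((a * a' + k) * N) by ring.
  rewrite ler_wpM2l ?mulr_ge0 // ler_pM // lerDr //.
have absE x y z : `|eps x y z| = 3 * `|f x y z - p ^+ 2|.
  by rewrite epsE normrM ger0_norm.
have := le_trans rhs lhs; rewrite /e1 /e2 /e3 /e4 !absE.
have -> : 2 * k ^+ 5 * `|a - a'| = 486 * (p ^+ 10 * `|a - a'|).
  by rewrite kE; ring.
by lra.
Qed.

(** The two faces at [a] multiply to [a ^ 2] times the other four weights, the two faces at [a'] to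
    [a' ^ 2] times the same four. If the errors are small all these weights are bounded below, and
    the difference of the products controls [a - a']. *)
Lemma opposite_edges_triangle (p a a' b b' c c' : R) (f := tri_poly 3) :
  0 < p <= 1 -> 0 <= a <= 1 -> 0 <= a' <= 1 -> 0 <= b <= 1 -> 0 <= b' <= 1 ->
  0 <= c <= 1 -> 0 <= c' <= 1 ->
  p ^+ 10 * `|a - a'| <= 6 * (`|f a b c' - p ^+ 3| + `|f a c b' - p ^+ 3| +
    `|f b c a' - p ^+ 3| + `|f c' b' a' - p ^+ 3|).
Proof.
move=> /andP[p0 p1] a01 a01' b01 b01' c01 c01'.
set k := p ^+ 3.
have k0 : 0 < k by rewrite exprn_gt0.
have k1 : k <= 1 by rewrite exprn_ile1 // ltW.
have f1 : 0 <= f a b c' <= 1 by exact: tri_poly_itv.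
have f2 : 0 <= f a c b' <= 1 by exact: tri_poly_itv.
have f3 : 0 <= f b c a' <= 1 by exact: tri_poly_itv.
have f4 : 0 <= f c' b' a' <= 1 by exact: tri_poly_itv.
set E1 := `|f a b c' - k|; set E2 := `|f a c b' - k|.
set E3 := `|f b c a' - k|; set E4 := `|f c' b' a' - k|.
have [E10 E20] : 0 <= E1 /\ 0 <= E2 by rewrite !normr_ge0.
have [E30 E40] : 0 <= E3 /\ 0 <= E4 by rewrite !normr_ge0.
have kn : `|k| <= 1 by rewrite ger0_norm // ltW.
have p10k : p ^+ 10 <= k ^+ 3.
  rewrite /k -exprM; apply: ler_wiXn2l => //; exact: ltW.
have k31 : k ^+ 3 <= k.
  have := ler_wiXn2l (ltW k0) k1 (isT : (1 <= 3)%N).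
  by rewrite expr1.
have d1 : `|a - a'| <= 1.
  by move: a01 a01' => /andP[? ?] /andP[? ?]; rewrite ler_norml;
    apply/andP; split; lra.
(* For a large total error the claim is trivial, as [a - a'] is at most [1] in absolute value and
   [p ^ 10 <= k]. *)
have [big|small] := leP (k / 2) (E1 + E2 + E3 + E4).
  have : p ^+ 10 * `|a - a'| <= k * 1.
    apply: ler_pM => //; [exact: exprn_ge0 (ltW p0)|exact: le_trans k31].
  lra.
have prod_le : `|f a b c' * f a c b' - f b c a' * f c' b' a'| <=
    E1 + E2 + E3 + E4.
  have -> : f a b c' * f a c b' - f b c a' * f c' b' a' =
    (f a b c' - k) * f a c b' + k * (f a c b' - k) -
    ((f b c a' - k) * f c' b' a' + k * (f c' b' a' - k)) by ring.
  have -> : E1 + E2 + E3 + E4 = E1 * 1 + 1 * E2 + (E3 * 1 + 1 * E4) by ring.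
  by apply: norm_sub_le; apply: norm_add_le; apply: norm_mul_le => //;
    exact: norm_itv_le1.
have lower x : `|x - k| <= k / 2 -> k / 2 <= x.
  by rewrite ler_norml => /andP[? _]; lra.
have l1 : k / 2 <= f a b c' by apply: lower; rewrite -/E1; lra.
have l2 : k / 2 <= f a c b' by apply: lower; rewrite -/E2; lra.
have l3 : k / 2 <= f b c a' by apply: lower; rewrite -/E3; lra.
have g1 : f a b c' <= b * c' by rewrite /f /= -mulrA ler_piMl ?mulr_ge0 //;
  [case/andP: b01 | case/andP: c01' | case/andP: a01].
have g2 : f a c b' <= c * b' by rewrite /f /= -mulrA ler_piMl ?mulr_ge0 //;
  [case/andP: c01 | case/andP: b01' | case/andP: a01].
have g3 : f b c a' <= a'.
  rewrite /f /= ler_piMl //; first by case/andP: a01'.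
  by rewrite mulr_ile1 //; [case/andP: b01 | case/andP: c01 | case/andP: b01 |
    case/andP: c01].
have g4 : f a b c' <= a.
  rewrite /f /= -mulrA ler_piMr //; first by case/andP: a01.
  by rewrite mulr_ile1 //; [case/andP: b01 | case/andP: c01' | case/andP: b01 |
    case/andP: c01'].
have key : k ^+ 3 / 4 * `|a - a'| <= E1 + E2 + E3 + E4.
  apply: le_trans prod_le.
  have -> : f a b c' * f a c b' - f b c a' * f c' b' a' =
    (b * c') * (c * b') * (a + a') * (a - a') by rewrite /f /=; ring.
  rewrite normrM ler_wpM2r //; apply: le_trans (ler_norm _).
  have -> : k ^+ 3 / 4 = (k / 2) * (k / 2) * k by field.
  have k20 : 0 <= k / 2 by rewrite divr_ge0 // ltW.
  have aa : k <= a + a'.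
    by rewrite [k]splitr; apply: lerD; [apply: le_trans g4|apply: le_trans g3].
  exact: ler_pM (mulr_ge0 k20 k20) (ltW k0)
    (ler_pM k20 k20 (le_trans l1 g1) (le_trans l2 g2)) aa.
have : p ^+ 10 * `|a - a'| <= k ^+ 3 * `|a - a'| by rewrite ler_wpM2r.
lra.
Qed.

(** For a single edge the relation is linear: every weight other than [a] and [a'] lies in one face
    at [a] and in one face at [a'], so it cancels in the signed sum of the four faces. *)
Lemma opposite_edges e (p a a' b b' c c' : R) (f := tri_poly e) :
  (0 < e <= 3)%N -> 0 < p <= 1 ->
  0 <= a <= 1 -> 0 <= a' <= 1 -> 0 <= b <= 1 -> 0 <= b' <= 1 ->
  0 <= c <= 1 -> 0 <= c' <= 1 ->
  p ^+ 10 * `|a - a'| <= 6 * (`|f a b c' - p ^+ e| + `|f a c b' - p ^+ e| +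
    `|f b c a' - p ^+ e| + `|f c' b' a' - p ^+ e|).
Proof.
rewrite {}/f; case: e => [|[|[|[|e]]]] // _ p01 a01 a01' b01 b01' c01 c01';
  [|exact: opposite_edges_cherry|exact: opposite_edges_triangle].
have /andP[p0 p1] := p01.
rewrite expr1 /=.
set e1 := _ / 3 - p; set e2 := _ / 3 - p; set e3 := _ / 3 - p.
set e4 := _ / 3 - p.
apply: le_trans (_ : 1 * `|a - a'| <= _).
  by rewrite ler_wpM2r // exprn_ile1 // ltW.
rewrite mul1r.
have -> : a - a' = 3 / 2 * ((e1 + e2) - (e3 + e4)).
  by rewrite /e1 /e2 /e3 /e4; field.
rewrite normrM ger0_norm //.
have : `|e1 + e2 - (e3 + e4)| <= `|e1| + `|e2| + (`|e3| + `|e4|).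
  by apply: norm_sub_le; apply: norm_add_le.
have := normr_ge0 e1; have := normr_ge0 e2.
have := normr_ge0 e3; have := normr_ge0 e4; lra.
Qed.

(** On the unit cube [f] is 1-Lipschitz for the l1 distance and equals [w ^ e] on the diagonal;
    [w ^ e - p ^ e] is [w - p] times a factor of at least [p ^ 2]. *)
Lemma near_constant e (p w x y z : R) (f := tri_poly e) :
  (0 < e <= 3)%N -> 0 < p <= 1 ->
  0 <= w <= 1 -> 0 <= x <= 1 -> 0 <= y <= 1 -> 0 <= z <= 1 ->
  p ^+ 2 * `|w - p| <=
    `|f x y z - p ^+ e| + (`|w - x| + `|w - y| + `|w - z|).
Proof.
rewrite {}/f => e13 p01 w01 x01 y01 z01.
have /andP[p0 p1] := p01; have /andP[w0 w1] := w01.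
have lip : `|w ^+ e - tri_poly e x y z| <= `|w - x| + `|w - y| + `|w - z|.
  case: e e13 => [|[|[|[|e]]]] // _; rewrite /tri_poly.
  - have -> : w ^+ 1 - (x + y + z) / 3 =
      (w - x) * 3^-1 + (w - y) * 3^-1 + (w - z) * 3^-1 by field.
    rewrite -[`|w - x|]mulr1 -[`|w - y|]mulr1 -[`|w - z|]mulr1.
    by apply: norm_add_le; [apply: norm_add_le|]; apply: norm_mul_le => //;
      rewrite ger0_norm; lra.
  - have -> : w ^+ 2 - (x * y + x * z + y * z) / 3 =
      (w - x) * ((y + z) / 3) + (w - y) * ((w + z) / 3) + (w - z) * ((w + w) / 3)
      by field.
    move: x01 y01 z01 => /andP[? ?] /andP[? ?] /andP[? ?].
    rewrite -[`|w - x|]mulr1 -[`|w - y|]mulr1 -[`|w - z|]mulr1.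
    by apply: norm_add_le; [apply: norm_add_le|]; apply: norm_mul_le => //;
      rewrite ger0_norm; lra.
  - have -> : w ^+ 3 - x * y * z =
      (w - x) * (y * z) + (w - y) * (w * z) + (w - z) * (w * w) by ring.
    rewrite -[`|w - x|]mulr1 -[`|w - y|]mulr1 -[`|w - z|]mulr1.
    have m1 u v : 0 <= u <= 1 -> 0 <= v <= 1 -> `|u * v| <= (1 : R).
      by move=> u01 v01; rewrite -[1]mulr1; apply: norm_mul_le;
        exact: norm_itv_le1.
    by apply: norm_add_le; [apply: norm_add_le|]; apply: norm_mul_le => //;
      exact: m1.
have pw : p ^+ 2 * `|w - p| <= `|w ^+ e - p ^+ e|.
  have p20 : 0 <= p ^+ 2 by rewrite exprn_ge0 // ltW.
  have wp : 0 <= w * p by rewrite mulr_ge0 // ltW.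
  have ww : 0 <= w ^+ 2 by exact: sqr_ge0.
  have pp : p ^+ 2 <= p by rewrite expr2 ler_piMl // ltW.
  case: e e13 {lip} => [|[|[|[|e]]]] // _.
  - by rewrite !expr1 ler_piMl // exprn_ile1 // ltW.
  - rewrite subr_sqr normrM mulrC ler_wpM2l // (@ger0_norm _ (w + p)); lra.
  - have -> : w ^+ 3 - p ^+ 3 = (w - p) * (w ^+ 2 + w * p + p ^+ 2) by ring.
    by rewrite normrM mulrC ler_wpM2l // (@ger0_norm _ (_ + _ + _)); lra.
apply: le_trans pw _.
have -> : w ^+ e - p ^+ e = (tri_poly e x y z - p ^+ e) +
  (w ^+ e - tri_poly e x y z) by ring.
exact: norm_add_le.
Qed.

End Pointwise.

(** * Averaging the pointwise inequalities over all vertices *)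

Section Averaged.
Variables (R : realType) (T : finType) (W : T -> T -> R) (e : nat) (p : R).
Hypothesis T0 : (0 < #|T|)%N.
Hypothesis W01 : forall x y, 0 <= W x y <= 1.
Hypothesis p01 : 0 < p <= 1.
Hypothesis e13 : (0 < e <= 3)%N.

Let err (x y z : T) : R := `|tri_poly e (W x y) (W x z) (W y z) - p ^+ e|.

Lemma sum_cst (c : R) : \sum_(x : T) c = #|T|%:R * c.
Proof. by rewrite sumr_const mulr_natl. Qed.

(** [opposite_edges] is summed over quadruples, giving [24 = 6 * 4], and [near_constant] over
    quintuples, comparing the pair [x y] with a free triangle [z u w]. The total is
    [73 = 1 + 3 * 24]. *)
Lemma dist_to_const_le :
  p ^+ 12 * #|T|%:R * \sum_x \sum_y `|W x y - p| <=
  73 * \sum_x \sum_y \sum_z err x y z.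
Proof.
set n : R := #|T|%:R; have n0 : 0 < n by rewrite ltr0n.
set S := \sum_x \sum_y \sum_z err x y z.
have /andP[p0 p1] := p01.
pose D := \sum_x \sum_y \sum_z \sum_u `|W x y - W z u|.
have DS : p ^+ 10 * D <= 24 * n * S.
  have -> : 24 * n * S = \sum_x \sum_y \sum_z \sum_u
      6 * (err x y z + err x y u + err x z u + err y z u).
    have -> : 24 * n * S = 6 * (n * S + n * S + n * S + n * S) by ring.
    have s1 : n * S = \sum_x \sum_y \sum_z \sum_(u : T) err x y z.
      rewrite /S !mulr_sumr; apply: eq_bigr => x _.
      rewrite !mulr_sumr; apply: eq_bigr => y _.
      by rewrite !mulr_sumr; apply: eq_bigr => z _; rewrite sum_cst.
    have s2 : n * S = \sum_x \sum_y \sum_(z : T) \sum_u err x y u.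
      rewrite /S !mulr_sumr; apply: eq_bigr => x _.
      by rewrite !mulr_sumr; apply: eq_bigr => y _; rewrite sum_cst.
    have s3 : n * S = \sum_x \sum_(y : T) \sum_z \sum_u err x z u.
      rewrite /S !mulr_sumr; apply: eq_bigr => x _.
      by rewrite sum_cst.
    have s4 : n * S = \sum_(x : T) \sum_y \sum_z \sum_u err y z u.
      by rewrite sum_cst.
    rewrite {1}s1 {1}s2 {1}s3 s4 -!big_split mulr_sumr /=; apply: eq_bigr => x _.
    rewrite -!big_split mulr_sumr /=; apply: eq_bigr => y _.
    rewrite -!big_split mulr_sumr /=; apply: eq_bigr => z _.
    by rewrite -!big_split mulr_sumr /=.
  rewrite /D mulr_sumr; apply: ler_sum => x _.
  rewrite mulr_sumr; apply: ler_sum => y _.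
  rewrite mulr_sumr; apply: ler_sum => z _.
  rewrite mulr_sumr; apply: ler_sum => u _.
  exact: opposite_edges.
have pD : p ^+ 2 * (n ^+ 3 * \sum_x \sum_y `|W x y - p|) <=
    n ^+ 2 * S + 3 * n * D.
  have -> : n ^+ 2 * S + 3 * n * D = \sum_x \sum_y \sum_z \sum_u \sum_w
     (err z u w + (`|W x y - W z u| + `|W x y - W z w| + `|W x y - W u w|)).
    have s0 : n ^+ 2 * S = \sum_(x : T) \sum_(y : T) \sum_z \sum_u \sum_w err z u w.
      by rewrite !sum_cst mulrA expr2.
    have s1 : n * D = \sum_x \sum_y \sum_z \sum_u \sum_(w : T) `|W x y - W z u|.
      rewrite /D !mulr_sumr; apply: eq_bigr => x _.
      rewrite !mulr_sumr; apply: eq_bigr => y _.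
      rewrite !mulr_sumr; apply: eq_bigr => z _.
      by rewrite !mulr_sumr; apply: eq_bigr => u _; rewrite sum_cst.
    have s2 : n * D = \sum_x \sum_y \sum_z \sum_(u : T) \sum_w `|W x y - W z w|.
      rewrite /D !mulr_sumr; apply: eq_bigr => x _.
      rewrite !mulr_sumr; apply: eq_bigr => y _.
      by rewrite !mulr_sumr; apply: eq_bigr => z _; rewrite sum_cst.
    have s3 : n * D = \sum_x \sum_y \sum_(z : T) \sum_u \sum_w `|W x y - W u w|.
      rewrite /D !mulr_sumr; apply: eq_bigr => x _.
      by rewrite !mulr_sumr; apply: eq_bigr => y _; rewrite sum_cst.
    have -> : 3 * n * D = n * D + n * D + n * D by ring.
    rewrite s0 {1}s1 {1}s2 s3 -!big_split /=; apply: eq_bigr => x _.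
    rewrite -!big_split /=; apply: eq_bigr => y _.
    rewrite -!big_split /=; apply: eq_bigr => z _.
    by rewrite -!big_split /=; apply: eq_bigr => u _; rewrite -!big_split.
  have -> : p ^+ 2 * (n ^+ 3 * \sum_x \sum_y `|W x y - p|) =
     \sum_x \sum_y \sum_(z : T) \sum_(u : T) \sum_(w : T) p ^+ 2 * `|W x y - p|.
    rewrite !mulr_sumr; apply: eq_bigr => x _.
    rewrite !mulr_sumr; apply: eq_bigr => y _.
    by rewrite !sum_cst -/n; ring.
  do 5 (apply: ler_sum => ? _); exact: near_constant.
have n20 : 0 < n ^+ 2 by rewrite exprn_gt0.
have S0 : 0 <= S by do 3 (apply: sumr_ge0 => ? _); exact: normr_ge0.
rewrite -(ler_pM2l n20).
have p101 : p ^+ 10 * (n ^+ 2 * S) <= n ^+ 2 * S.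
  by rewrite ler_piMl ?mulr_ge0 ?exprn_ile1 ?(ltW n20) // ltW.
have p100 : 0 <= p ^+ 10 by rewrite exprn_ge0 // ltW.
have := ler_wpM2l p100 pD.
have -> : p ^+ 10 * (p ^+ 2 * (n ^+ 3 * \sum_x \sum_y `|W x y - p|)) =
  n ^+ 2 * (p ^+ 12 * n * \sum_x \sum_y `|W x y - p|) by ring.
move=> h; apply: (le_trans h); rewrite mulrDr.
have : 3 * n * (p ^+ 10 * D) <= 3 * n * (24 * n * S).
  by rewrite ler_wpM2l // mulr_ge0 // ltW.
have -> : 3 * n * (24 * n * S) = 72 * (n ^+ 2 * S) by ring.
have -> : 3 * n * (p ^+ 10 * D) = p ^+ 10 * (3 * n * D) by ring.
have -> : n ^+ 2 * (73 * S) = 73 * (n ^+ 2 * S) by ring.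
lra.
Qed.

End Averaged.

(** * Counting in the cells of a regular partition *)

Section CellSums.
Variables (R : realType) (T C : finType) (pi : T -> C).

Definition cell3 (F : T -> T -> T -> R) (i j k : C) : R :=
  \sum_(x | pi x == i) \sum_(y | pi y == j) \sum_(z | pi z == k) F x y z.

(** Cancellation is allowed inside a product of three cells, not between different products. *)
Definition cell_l1 (F : T -> T -> T -> R) : R :=
  \sum_i \sum_j \sum_k `|cell3 F i j k|.

Lemma sum_cells3 (F : T -> T -> T -> R) :
  \sum_x \sum_y \sum_z F x y z = \sum_i \sum_j \sum_k cell3 F i j k.
Proof.
rewrite (sum_cells pi); apply: eq_bigr => i _; apply: eq_bigr => j _.
rewrite [RHS]exchange_big /=; apply: eq_bigr => x _.
rewrite [RHS]exchange_big /=; apply: eq_bigr => y _.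
by rewrite (partition_big pi xpredT).
Qed.

Lemma cell_l1D (F G : T -> T -> T -> R) :
  cell_l1 (fun x y z => F x y z + G x y z) <= cell_l1 F + cell_l1 G.
Proof.
rewrite /cell_l1 -big_split /=; apply: ler_sum => i _.
rewrite -big_split /=; apply: ler_sum => j _.
rewrite -big_split /=; apply: ler_sum => k _.
apply: le_trans (ler_normD _ _); rewrite /cell3 -big_split /=.
apply: eq_ler; congr `|_|; apply: eq_bigr => x _.
by rewrite -big_split /=; apply: eq_bigr => y _; rewrite -big_split.
Qed.

Lemma cell_l1Z (c : R) (F : T -> T -> T -> R) :
  cell_l1 (fun x y z => c * F x y z) = `|c| * cell_l1 F.
Proof.
rewrite /cell_l1 mulr_sumr; apply: eq_bigr => i _.
rewrite mulr_sumr; apply: eq_bigr => j _.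
rewrite mulr_sumr; apply: eq_bigr => k _.
rewrite -normrM /cell3 mulr_sumr; congr `|_|; apply: eq_bigr => x _.
by rewrite mulr_sumr; apply: eq_bigr => y _; rewrite mulr_sumr.
Qed.

Lemma cell_l1_ext (F G : T -> T -> T -> R) :
  (forall x y z, F x y z = G x y z) -> cell_l1 F = cell_l1 G.
Proof.
move=> FG; congr cell_l1; apply/funext => x; apply/funext => y.
by apply/funext => z.
Qed.

Lemma cell_l1_le (F : T -> T -> T -> R) :
  cell_l1 F <= \sum_x \sum_y \sum_z `|F x y z|.
Proof.
rewrite sum_cells3; do 3 (apply: ler_sum => ? _); rewrite /cell3.
apply: le_trans (ler_norm_sum _ _ _) _; apply: ler_sum => x _.
apply: le_trans (ler_norm_sum _ _ _) _; apply: ler_sum => y _.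
exact: ler_norm_sum.
Qed.

(** A function constant on products of cells has no cancellation there. This turns a bound on cell
    sums into a pointwise one for expressions in the block averages. *)
Lemma cell_l1_const (F : T -> T -> T -> R) (G : C -> C -> C -> R) :
  (forall x y z, F x y z = G (pi x) (pi y) (pi z)) ->
  \sum_x \sum_y \sum_z `|F x y z| = cell_l1 F.
Proof.
move=> FG; rewrite sum_cells3.
apply: eq_bigr => i _; apply: eq_bigr => j _; apply: eq_bigr => k _.
rewrite /cell3.
have [g0|g0] := leP 0 (G i j k).
  rewrite ger0_norm; last first.
    apply: sumr_ge0 => x /eqP xi; apply: sumr_ge0 => y /eqP yj.
    by apply: sumr_ge0 => z /eqP zk; rewrite FG xi yj zk.
  apply: eq_bigr => x /eqP xi; apply: eq_bigr => y /eqP yj.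
  by apply: eq_bigr => z /eqP zk; rewrite FG xi yj zk ger0_norm.
rewrite ler0_norm; last first.
  apply: sumr_le0 => x /eqP xi; apply: sumr_le0 => y /eqP yj.
  by apply: sumr_le0 => z /eqP zk; rewrite FG xi yj zk ltW.
rewrite -sumrN; apply: eq_bigr => x /eqP xi.
rewrite -sumrN; apply: eq_bigr => y /eqP yj.
by rewrite -sumrN; apply: eq_bigr => z /eqP zk; rewrite FG xi yj zk ltr0_norm.
Qed.

Lemma cell_l1_fix3 (F : T -> T -> T -> R) (M : R) :
  (forall z, \sum_i \sum_j
    `|\sum_(x | pi x == i) \sum_(y | pi y == j) F x y z| <= M) ->
  cell_l1 F <= #|T|%:R * M.
Proof.
move=> FM; rewrite -sum_cst.
apply: le_trans (ler_sum _ (fun z _ => FM z)).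
rewrite /cell_l1 [leRHS]exchange_big /=; apply: ler_sum => i _.
rewrite [leRHS]exchange_big /=; apply: ler_sum => j _.
rewrite [leRHS](partition_big pi xpredT) //=; apply: ler_sum => k _.
rewrite /cell3.
have -> : \sum_(x | pi x == i) \sum_(y | pi y == j) \sum_(z | pi z == k) F x y z =
    \sum_(z | pi z == k) \sum_(x | pi x == i) \sum_(y | pi y == j) F x y z.
  rewrite [RHS]exchange_big /=; apply: eq_bigr => x _.
  by rewrite [RHS]exchange_big.
exact: ler_norm_sum.
Qed.

Lemma cell_l1_swap23 (F : T -> T -> T -> R) :
  cell_l1 F = cell_l1 (fun x z y => F x y z).
Proof.
rewrite /cell_l1; apply: eq_bigr => i _; rewrite exchange_big /=.
apply: eq_bigr => k _; apply: eq_bigr => j _; congr `|_|.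
by rewrite /cell3; apply: eq_bigr => x _; rewrite exchange_big.
Qed.

Lemma cell_l1_swap12 (F : T -> T -> T -> R) :
  cell_l1 F = cell_l1 (fun y x z => F x y z).
Proof.
rewrite /cell_l1 exchange_big /=; apply: eq_bigr => j _.
apply: eq_bigr => i _; apply: eq_bigr => k _; congr `|_|.
by rewrite /cell3 exchange_big.
Qed.

Lemma cell_l1_fix2 (F : T -> T -> T -> R) (M : R) :
  (forall y, \sum_i \sum_k
    `|\sum_(x | pi x == i) \sum_(z | pi z == k) F x y z| <= M) ->
  cell_l1 F <= #|T|%:R * M.
Proof. by move=> FM; rewrite cell_l1_swap23; exact: cell_l1_fix3. Qed.

Lemma cell_l1_fix1 (F : T -> T -> T -> R) (M : R) :
  (forall x, \sum_j \sum_k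
    `|\sum_(y | pi y == j) \sum_(z | pi z == k) F x y z| <= M) ->
  cell_l1 F <= #|T|%:R * M.
Proof. by move=> FM; rewrite cell_l1_swap12; exact: cell_l1_fix2. Qed.

End CellSums.

Section CellCounting.
Variables (R : realType) (T C : finType) (pi : T -> C) (A : rel T) (eta : R).

Let adjR (x y : T) : R := (A x y)%:R.
Let W := block_avg pi adjR.
Hypothesis eta0 : 0 <= eta.
Hypothesis reg : regular_partition pi adjR eta.

Definition kern (b : bool) (g : T -> T -> R) (x y : T) : R :=
  if b then g x y else 1.

(** The booleans select the edges of a labelled graph on [x], [y], [z]. An unselected pair
    contributes [1], because homomorphisms are counted and not induced copies. *)
Definition mono (b1 b2 b3 : bool) (g : T -> T -> R) (x y z : T) : R :=
  kern b1 g x y * kern b2 g x z * kern b3 g y z.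

Lemma adjR_itv x y : 0 <= adjR x y <= 1.
Proof. by rewrite /adjR; case: (A x y); rewrite ?lexx ?ler01. Qed.

Lemma kern_adjE b x y : kern b adjR x y = (b ==> A x y)%:R.
Proof. by case: b. Qed.

Lemma kern_cell b x y :
  kern b W x y = if b then cell_avg pi adjR (pi x) (pi y) else 1.
Proof. by []. Qed.

Lemma cell_coef_le b i j x y : pi x = i -> pi y = j ->
  `|if b then cell_avg pi adjR i j else 1| <= 1.
Proof.
move=> <- <-; case: b; last by rewrite normr1.
exact: norm_itv_le1 (block_avg_itv pi x y adjR_itv).
Qed.

(** A coefficient depending only on the two cells comes out of the inner absolute value in
    [regular_partition]. *)
Lemma regular_weighted b (c : C -> C -> R) (P Q : pred T) :
  (forall x y, `|c (pi x) (pi y)| <= 1) ->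
  \sum_i \sum_j `|\sum_(x | pi x == i) \sum_(y | pi y == j)
    (kern b adjR x y - kern b W x y) * (c i j * ((P x)%:R * (Q y)%:R))|
  <= eta * #|T|%:R ^+ 2.
Proof.
move=> c1; case: b => /=; last first.
  rewrite big1 ?mulr_ge0 ?exprn_ge0 // => i _; rewrite big1 // => j _.
  by rewrite big1 ?normr0 // => x _; rewrite big1 // => y _; rewrite subrr mul0r.
apply: le_trans (reg (fun _ _ => [set x | P x]%SET) (fun _ _ => [set x | Q x]%SET)).
apply: ler_sum => i _; apply: ler_sum => j _.
have -> : \sum_(x | pi x == i) \sum_(y | pi y == j)
    (adjR x y - W x y) * (c i j * ((P x)%:R * (Q y)%:R)) =
  c i j * \sum_(x | pi x == i) \sum_(y | pi y == j)
    (adjR x y - W x y) * ((P x)%:R * (Q y)%:R).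
  rewrite mulr_sumr; apply: eq_bigr => x _; rewrite mulr_sumr.
  by apply: eq_bigr => y _; rewrite mulrCA.
under [X in _ <= `|X|]eq_bigr => x _.
  under eq_bigr => y _ do rewrite !inE.
  over.
rewrite -/W normrM.
(* [c] is bounded only on pairs of nonempty cells; any other pair has an empty sum. *)
have [/existsP[x /existsP[y /andP[/eqP xi /eqP yj]]]|none] :=
  boolP [exists x, exists y, (pi x == i) && (pi y == j)].
  by rewrite ler_piMl // -xi -yj.
have -> : \sum_(x | pi x == i) \sum_(y | pi y == j)
    (adjR x y - W x y) * ((P x)%:R * (Q y)%:R) = 0.
  rewrite big1 // => x xi; rewrite big1 // => y yj.
  case/negP: none; apply/existsP; exists x; apply/existsP; exists y.
  by rewrite xi yj.
by rewrite normr0 mulr0.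
Qed.

(** One edge is replaced at a time with the third vertex fixed. The factors not yet replaced are
    then indicators of sets and those already replaced are constant on cells, which is what
    [regular_weighted] admits. *)
Lemma mono_counting b1 b2 b3 :
  cell_l1 pi (fun x y z => mono b1 b2 b3 adjR x y z - mono b1 b2 b3 W x y z)
  <= 3 * eta * #|T|%:R ^+ 3.
Proof.
pose dk b x y := kern b adjR x y - kern b W x y.
pose F1 x y z := dk b1 x y * (kern b2 adjR x z * kern b3 adjR y z).
pose F2 x y z := dk b2 x z * (kern b1 W x y * kern b3 adjR y z).
pose F3 x y z := dk b3 y z * (kern b1 W x y * kern b2 W x z).
rewrite (@cell_l1_ext _ _ _ _ _ (fun x y z => F1 x y z + F2 x y z + F3 x y z));
  last by move=> x y z; rewrite /F1 /F2 /F3 /mono /dk; ring.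
apply: le_trans (cell_l1D _ _ _) _.
have -> : 3 * eta * #|T|%:R ^+ 3 = #|T|%:R * (eta * #|T|%:R ^+ 2) +
  #|T|%:R * (eta * #|T|%:R ^+ 2) + #|T|%:R * (eta * #|T|%:R ^+ 2) by ring.
apply: lerD; first (apply: le_trans (cell_l1D _ _ _) _; apply: lerD).
- apply: cell_l1_fix3 => z.
  apply: le_trans (@regular_weighted b1 (fun _ _ => 1)
    (fun x => b2 ==> A x z) (fun y => b3 ==> A y z) _); last first.
    by move=> *; rewrite normr1.
  apply: eq_ler; apply: eq_bigr => i _; apply: eq_bigr => j _; congr `|_|.
  apply: eq_bigr => x _; apply: eq_bigr => y _.
  by rewrite /F1 /dk !kern_adjE mul1r.
- apply: cell_l1_fix2 => y.
  apply: le_trans (@regular_weighted b2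
    (fun i _ => if b1 then cell_avg pi adjR i (pi y) else 1)
    (fun x => true) (fun z => b3 ==> A y z) _); last first.
    by move=> x z; exact: cell_coef_le.
  apply: eq_ler; apply: eq_bigr => i _; apply: eq_bigr => k _; congr `|_|.
  apply: eq_bigr => x /eqP xi; apply: eq_bigr => z _.
  by rewrite /F2 /dk !kern_adjE [kern b1 W x y]kern_cell xi mul1r.
- apply: cell_l1_fix1 => x.
  apply: le_trans (@regular_weighted b3
    (fun j k => (if b1 then cell_avg pi adjR (pi x) j else 1) *
                (if b2 then cell_avg pi adjR (pi x) k else 1))
    (fun=> true) (fun=> true) _); last first.
    by move=> y z; rewrite -[leRHS]mulr1; apply: norm_mul_le;
      exact: cell_coef_le.
  apply: eq_ler; apply: eq_bigr => j _; apply: eq_bigr => k _; congr `|_|.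
  apply: eq_bigr => y /eqP yj; apply: eq_bigr => z /eqP zk.
  by rewrite /F3 /dk [kern b1 W x y]kern_cell [kern b2 W x z]kern_cell yj zk !mulr1.
Qed.

Definition tri_val (e : nat) (g : T -> T -> R) (x y z : T) : R :=
  tri_poly e (g x y) (g x z) (g y z).

Lemma tri_counting e : (0 < e <= 3)%N ->
  cell_l1 pi (fun x y z => tri_val e adjR x y z - tri_val e W x y z)
  <= 3 * eta * #|T|%:R ^+ 3.
Proof.
pose d b1 b2 b3 x y z := mono b1 b2 b3 adjR x y z - mono b1 b2 b3 W x y z.
have avg (f g h : T -> T -> T -> R) M : cell_l1 pi f <= M -> cell_l1 pi g <= M ->
    cell_l1 pi h <= M ->
    cell_l1 pi (fun x y z => 3^-1 * (f x y z + g x y z + h x y z)) <= M.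
  move=> fM gM hM; rewrite cell_l1Z ger0_norm //.
  have := cell_l1D pi (fun x y z => f x y z + g x y z) h.
  have := cell_l1D pi f g; lra.
case: e => [|[|[|[|e]]]] // _.
- rewrite (@cell_l1_ext _ _ _ _ _ (fun x y z => 3^-1 *
    (d true false false x y z + d false true false x y z +
     d false false true x y z))).
    by apply: avg; exact: mono_counting.
  by move=> x y z; rewrite /tri_val /d /mono /kern /=; field.
- rewrite (@cell_l1_ext _ _ _ _ _ (fun x y z => 3^-1 *
    (d true true false x y z + d true false true x y z +
     d false true true x y z))).
    by apply: avg; exact: mono_counting.
  by move=> x y z; rewrite /tri_val /d /mono /kern /=; field.
- exact: (mono_counting true true true).
Qed.

End CellCounting.

(** * From small local defects to small discrepancy *)

Section LocalCounts.
Variables (R : realType) (T : finType) (A : rel T) (e : nat) (p : R).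
Hypothesis Asym : symmetric A.
Hypothesis p01 : 0 < p <= 1.
Hypothesis e13 : (0 < e <= 3)%N.

Definition disc (q eps : R) : Prop := forall X Y : {set T},
  `|\sum_x \sum_y ((A x y)%:R - q) * (ind R X x * ind R Y y)|
  <= eps * #|T|%:R ^+ 2.

Definition distinct3 (x y z : T) : bool := [&& x != y, x != z & y != z].

Let adjR (x y : T) : R := (A x y)%:R.

(** Zero on degenerate triples, so that [offdiag] holds and rounding applies; in a sum over all
    triples this changes at most [3 * n ^ 2]. *)
Definition defect (x y z : T) : R :=
  if distinct3 x y z then tri_val e adjR x y z - p ^+ e else 0.

Lemma pe_itv : 0 <= p ^+ e <= 1.
Proof.
by case/andP: p01 => p0 p1; rewrite exprn_ge0 ?exprn_ile1 // ltW.
Qed.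

Lemma defect_offdiag : offdiag defect.
Proof. by move=> x y; rewrite /defect /distinct3 !eqxx ?andbF. Qed.

Lemma tri_val_defect_le x y z : `|tri_val e adjR x y z - p ^+ e| <= 1.
Proof.
have /andP[? ?] := pe_itv.
have /andP[t0 t1] : 0 <= tri_val e adjR x y z <= 1.
  by apply: tri_poly_itv; exact: adjR_itv.
by rewrite ler_norml; apply/andP; split; lra.
Qed.

Lemma defect_le1 x y z : `|defect x y z| <= 1.
Proof.
rewrite /defect; case: ifP => _; last by rewrite normr0.
exact: tri_val_defect_le.
Qed.

Lemma defectC12 x y z : defect x y z = defect y x z.
Proof.
rewrite /defect /distinct3 [y == x]eq_sym [(y != z) && _]andbC /tri_val.
by rewrite tri_polyC23 /adjR [A y x]Asym.
Qed.

Lemma defectC23 x y z : defect x y z = defect x z y.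
Proof.
rewrite /defect /distinct3 [z == y]eq_sym andbCA /tri_val.
by rewrite tri_polyC12 /adjR [A z y]Asym.
Qed.

Lemma sum_eq1 (y : T) : \sum_x (x == y)%:R = 1 :> R.
Proof. by rewrite (bigD1 y) //= eqxx big1 ?addr0 // => x /negbTE ->. Qed.

Lemma sum_coincidences_le (F : T -> T -> T -> R) :
  (forall x y z, `|F x y z| <= if distinct3 x y z then 0 else 1) ->
  \sum_x \sum_y \sum_z `|F x y z| <= 3 * #|T|%:R ^+ 2.
Proof.
move=> F1.
apply: le_trans (_ : \sum_(x : T) \sum_(y : T) \sum_(z : T)
    ((x == y)%:R + (x == z)%:R + (y == z)%:R) <= _).
  do 3 (apply: ler_sum => ? _); apply: le_trans (F1 _ _ _) _.
  rewrite /distinct3 -!negb_or; do 3 case: eqP => _ /=;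
    rewrite ?addr0 ?add0r ?lexx //; lra.
set n : R := #|T|%:R.
have n2 : n ^+ 2 = \sum_(x : T) n by rewrite sum_cst expr2.
have eq1 (x : T) : \sum_y (x == y)%:R = 1 :> R.
  by under eq_bigr do rewrite eq_sym; rewrite sum_eq1.
have s1 : \sum_(x : T) \sum_(y : T) \sum_(z : T) (x == y)%:R = n ^+ 2.
  rewrite n2; apply: eq_bigr => x _; under eq_bigr do rewrite sum_cst.
  by rewrite -mulr_sumr eq1 mulr1.
have s2 : \sum_(x : T) \sum_(y : T) \sum_(z : T) (x == z)%:R = n ^+ 2.
  by rewrite n2; apply: eq_bigr => x _; rewrite sum_cst eq1 mulr1.
have s3 : \sum_(x : T) \sum_(y : T) \sum_(z : T) (y == z)%:R = n ^+ 2.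
  rewrite n2; apply: eq_bigr => x _; under eq_bigr do rewrite eq1.
  by rewrite sum_cst mulr1.
have -> : 3 * n ^+ 2 = n ^+ 2 + n ^+ 2 + n ^+ 2 by ring.
rewrite -{1}s1 -{1}s2 -s3 -!big_split; apply: ler_sum => x _.
rewrite -!big_split; apply: ler_sum => y _.
by rewrite -!big_split.
Qed.

Lemma tri_cells (C : finType) (pi : T -> C) (F : T -> T -> T -> R) i j k :
  tri F (ind R [set x | pi x == i]%SET) (ind R [set x | pi x == j]%SET)
    (ind R [set x | pi x == k]%SET) = cell3 pi F i j k.
Proof.
rewrite /tri /cell3 [RHS]big_mkcond /=; apply: eq_bigr => x _.
case: ifPn => xi; last first.
  rewrite big1 // => y _; rewrite big1 // => z _.
  by rewrite /ind !inE (negbTE xi) !mul0r mulr0.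
rewrite [RHS]big_mkcond /=; apply: eq_bigr => y _.
case: ifPn => yj; last first.
  by rewrite big1 // => z _; rewrite /ind !inE (negbTE yj) mulr0 mul0r mulr0.
rewrite [RHS]big_mkcond /=; apply: eq_bigr => z _.
by rewrite /ind !inE xi yj !mul1r; case: ifP => _; rewrite ?mulr1 ?mulr0.
Qed.

(** The bound [eps1] is applied to every triple of cells, hence the cube of [#|C|]. Then [A - p]
    splits into [A - W], controlled by regularity, and [W - p], controlled in l1 by
    [dist_to_const_le]. *)
Lemma disc_of_cells (C : finType) (pi : T -> C) (eta eps1 : R) :
  (0 < #|T|)%N -> 0 <= eta -> regular_partition pi adjR eta ->
  (forall X Y Z : {set T},
    `|tri defect (ind R X) (ind R Y) (ind R Z)| <= eps1) ->
  forall eps : R,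
  eta * #|T|%:R ^+ 2 + 73 / p ^+ 12 / #|T|%:R *
    (3 * eta * #|T|%:R ^+ 3 + #|C|%:R ^+ 3 * eps1 + 3 * #|T|%:R ^+ 2)
    <= eps * #|T|%:R ^+ 2 -> disc p eps.
Proof.
move=> T0 eta0 reg small eps epsE X Y; apply: le_trans epsE.
set n : R := #|T|%:R; have n0 : 0 < n by rewrite ltr0n.
have /andP[p0 p1] := p01.
have p120 : 0 < p ^+ 12 by rewrite exprn_gt0.
pose W := block_avg pi adjR.
have l1 : cell_l1 pi (fun x y z => tri_val e adjR x y z - p ^+ e) <=
    #|C|%:R ^+ 3 * eps1 + 3 * n ^+ 2.
  rewrite (@cell_l1_ext _ _ _ _ _ (fun x y z => defect x y z +
    (tri_val e adjR x y z - p ^+ e - defect x y z))); last first.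
    by move=> x y z; ring.
  apply: le_trans (cell_l1D _ _ _) _; apply: lerD.
    have -> : #|C|%:R ^+ 3 * eps1 =
        \sum_(i : C) \sum_(j : C) \sum_(k : C) eps1.
      by rewrite !sum_cst; ring.
    by do 3 (apply: ler_sum => ? _); rewrite -tri_cells; exact: small.
  apply: le_trans (cell_l1_le _ _) _; apply: sum_coincidences_le => x y z.
  rewrite /defect; case: ifP => _; first by rewrite subrr normr0.
  by rewrite subr0 tri_val_defect_le.
have S_le : \sum_x \sum_y \sum_z `|tri_val e W x y z - p ^+ e| <=
    3 * eta * n ^+ 3 + (#|C|%:R ^+ 3 * eps1 + 3 * n ^+ 2).
  rewrite (@cell_l1_const _ _ _ pi _ (fun i j k => tri_poly e (cell_avg pi adjR i j)
    (cell_avg pi adjR i k) (cell_avg pi adjR j k) - p ^+ e)) //.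
  rewrite (@cell_l1_ext _ _ _ _ _ (fun x y z =>
    -1 * (tri_val e adjR x y z - tri_val e W x y z) +
    (tri_val e adjR x y z - p ^+ e))); last by move=> x y z; ring.
  apply: le_trans (cell_l1D _ _ _) _; apply: lerD l1.
  by rewrite cell_l1Z normrN1 mul1r; exact: tri_counting.
have W01 x y : 0 <= W x y <= 1 by apply: block_avg_itv; exact: adjR_itv.
have Wp := dist_to_const_le T0 W01 p01 e13.
have Wp' : \sum_x \sum_y `|W x y - p| <= 73 / p ^+ 12 / n *
    (3 * eta * n ^+ 3 + #|C|%:R ^+ 3 * eps1 + 3 * n ^+ 2).
  have pn : 0 < p ^+ 12 * n by rewrite mulr_gt0.
  rewrite -(ler_pM2l pn); apply: le_trans Wp _.
  have -> : p ^+ 12 * n * (73 / p ^+ 12 / n *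
    (3 * eta * n ^+ 3 + #|C|%:R ^+ 3 * eps1 + 3 * n ^+ 2)) =
    73 * (3 * eta * n ^+ 3 + (#|C|%:R ^+ 3 * eps1 + 3 * n ^+ 2)).
    by field; rewrite !gt_eqF.
  by rewrite ler_wpM2l.
have -> : \sum_x \sum_y ((A x y)%:R - p) * (ind R X x * ind R Y y) =
    \sum_x \sum_y (adjR x y - W x y) * (ind R X x * ind R Y y) +
    \sum_x \sum_y (W x y - p) * (ind R X x * ind R Y y).
  rewrite -big_split; apply: eq_bigr => x _; rewrite -big_split.
  by apply: eq_bigr => y _ /=; rewrite /adjR; ring.
apply: norm_add_le.
  rewrite (sum_cells pi); apply: le_trans (reg (fun _ _ => X) (fun _ _ => Y)).
  apply: le_trans (ler_norm_sum _ _ _) _; apply: ler_sum => i _.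
  exact: ler_norm_sum.
apply: le_trans Wp'.
apply: le_trans (ler_norm_sum _ _ _) _; apply: ler_sum => x _.
apply: le_trans (ler_norm_sum _ _ _) _; apply: ler_sum => y _.
rewrite normrM ler_piMr // -[leRHS]mulr1.
by apply: norm_mul_le; apply: norm_itv_le1; exact: ind_itv.
Qed.

End LocalCounts.

(** * The choice of constants *)

Section LocalToGlobal.
Variable R : realType.

Lemma polar_const_gt0 (alpha beta : R) : 0 < alpha -> 0 < beta ->
  alpha + beta < 1 -> 0 < polar_const alpha beta.
Proof.
move=> a0 b0 ab1; have m0 := margin_gt0 a0 b0 ab1.
rewrite /polar_const.
have k0 : 0 < 2 / margin alpha beta by rewrite divr_gt0.
by rewrite !addr_gt0 ?mulr_gt0 ?invr_gt0 ?exprn_gt0 ?mulr_gt0 ?exprn_gt0.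
Qed.

(** Constants are fixed in the order [eta], [K], [delta], [N]. As [K] depends only on [eta], [delta]
    can absorb both the number of triples of cells and the polarization constant. *)
Lemma disc_of_local_counts (alpha beta p eps : R) (e : nat) :
  0 < alpha -> 0 < beta -> alpha + beta < 1 -> 0 < p <= 1 -> (0 < e <= 3)%N ->
  0 < eps -> exists (delta : R) (N : nat), 0 < delta /\
  forall (T : finType) (A : rel T) (a b : nat), symmetric A -> (N < #|T|)%N ->
    (a + b <= #|T|)%N -> `|alpha * #|T|%:R - a%:R| <= 1 ->
    `|beta * #|T|%:R - b%:R| <= 1 ->
    (forall U U' : {set T}, [disjoint U & U']%B -> #|U| = a -> #|U'| = b ->
      `|tri (defect A e p) (ind R U) (ind R U) (ind R U')|
        <= delta * #|T|%:R ^+ 3) ->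
    disc A p eps.
Proof.
move=> alpha0 beta0 ab1 p01 e13 eps0.
have /andP[p0 p1] := p01.
have [c cE] : exists c : R, c = 73 / p ^+ 12 by eexists.
have c1 : 1 <= c.
  have p12 : p ^+ 12 <= 1 by rewrite exprn_ile1 // ltW.
  rewrite cE ler_pdivlMr ?exprn_gt0 //; lra.
have c0 : 0 < c by lra.
(* The final sum uses six of the eight shares: one for regularity itself, three for counting, one
   for the triples of cells and one for degenerate triples. *)
have [eta etaE] : exists eta : R, eta = eps / (8 * c) by eexists.
have eta0 : 0 < eta by rewrite etaE divr_gt0 // mulr_gt0.
have [K regK] := regularity eta0.
have [K0 K0E] : exists k, k = polar_const alpha beta by eexists.
have K00 : 0 < K0 by rewrite K0E polar_const_gt0.
(* The successor makes [k3] positive whatever [K] is. *)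
have [k3 k3E] : exists k : R, k = K.+1%:R ^+ 3 by eexists.
have k30 : 0 < k3 by rewrite k3E exprn_gt0 // ltr0n.
have [delta dE] : exists d : R, d = eps / (8 * c * k3 * (4 * K0)) by eexists.
have delta0 : 0 < delta.
  rewrite dE divr_gt0 //.
  exact: mulr_gt0 (mulr_gt0 (mulr_gt0 (ltr0n _ 8) c0) k30) (mulr_gt0 _ K00).
(* The first threshold absorbs the quadratic error of rounding, the second the degenerate
   triples. *)
pose N := maxn (Num.bound ((3 + 2 / delta) / delta)) (Num.bound (24 * c / eps)).
exists delta, N; split=> // T A a b Asym NT abT aE bE loc.
set n : R := #|T|%:R in aE bE loc.
have T0 : (0 < #|T|)%N by exact: leq_ltn_trans (leq0n _) NT.
have n0 : 0 < n by rewrite ltr0n.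
have nN (x : R) : 0 <= x -> (Num.bound x <= N)%N -> x <= n.
  move=> x0 xN; apply: ltW; apply: (lt_le_trans (archi_boundP x0)).
  by rewrite ler_nat; apply: leq_trans xN (ltnW NT).
have n1 : (3 + 2 / delta) / delta <= n.
  apply: nN; last exact: leq_maxl.
  by rewrite divr_ge0 ?addr_ge0 ?divr_ge0 ?(ltW delta0).
have n2 : 24 * c / eps <= n.
  apply: nN; last exact: leq_maxr.
  by rewrite divr_ge0 ?mulr_ge0 ?(ltW c0) ?(ltW eps0).
have [C [pi [CK reg]]] := regK T (fun x y => (A x y)%:R) T0 (adjR_itv R A).
(* One [delta] from the hypothesis, two from rounding with [theta = delta], and one for the
   quadratic error. *)
pose M := 4 * delta * n ^+ 3.
have frac s t : subdistr s t -> \sum_x s x = alpha * n -> \sum_x t x = beta * n ->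
    `|tri (defect A e p) s s t| <= M.
  move=> st sE tE.
  have := @fractional_norm_le R T (defect A e p) s t a b (delta * n ^+ 3) delta.
  rewrite sE tE => /(_ (defect_offdiag A e p) (defect_le1 A e p01) delta0).
  move=> /(_ st T0 abT aE bE loc) h; apply: (le_trans h).
  have : (3 + 2 / delta) * n ^+ 2 <= delta * n ^+ 3.
    move: n1; rewrite ler_pdivrMr // => n1.
    have -> : delta * n ^+ 3 = (n * delta) * n ^+ 2 by ring.
    by rewrite ler_wpM2r // exprn_ge0 // ltW.
  by rewrite /M -/n; lra.
have small X Y Z : `|tri (defect A e p) (ind R X) (ind R Y) (ind R Z)| <= K0 * M.
  rewrite K0E; apply: tri_ind_le => //; [exact: defectC12|exact: defectC23].
refine (disc_of_cells p01 e13 T0 (ltW eta0) reg small _).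
rewrite -/n -cE.
have C3 : #|C|%:R ^+ 3 <= k3 by rewrite k3E lerXn2r ?nnegrE // ler_nat leqW.
have M0 : 0 <= K0 * M.
  by rewrite !mulr_ge0 ?exprn_ge0 // ltW.
have e1 : #|C|%:R ^+ 3 * (K0 * M) <= k3 * (K0 * M) by rewrite ler_wpM2r.
have e2 : k3 * (K0 * M) = eps / (8 * c) * n ^+ 3.
  by rewrite /M dE; field; rewrite !gt_eqF.
have e3 : 3 * n ^+ 2 <= eps / (8 * c) * n ^+ 3.
  have -> : eps / (8 * c) * n ^+ 3 = (eps / (8 * c) * n) * n ^+ 2 by ring.
  rewrite ler_wpM2r ?exprn_ge0 ?(ltW n0) //.
  have -> : (3 : R) = eps / (8 * c) * (24 * c / eps).
    by field; rewrite !gt_eqF.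
  by rewrite ler_wpM2l // ltW // divr_gt0 // mulr_gt0.
have e4 : eta * n ^+ 2 <= eps / 8 * n ^+ 2.
  rewrite ler_wpM2r ?exprn_ge0 ?(ltW n0) // etaE ler_pM2l //.
  by rewrite lef_pV2 ?posrE ?mulr_gt0 //; lra.
have cn : 0 <= c / n by rewrite divr_ge0 // ltW.
have e5 : c / n * (3 * eta * n ^+ 3 + #|C|%:R ^+ 3 * (K0 * M) + 3 * n ^+ 2) <=
    c / n * (3 * eta * n ^+ 3 + eps / (8 * c) * n ^+ 3 + eps / (8 * c) * n ^+ 3).
  by rewrite ler_wpM2l //; lra.
have e6 : c / n * (3 * eta * n ^+ 3 + eps / (8 * c) * n ^+ 3 +
    eps / (8 * c) * n ^+ 3) = 5 / 8 * eps * n ^+ 2.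
  by rewrite etaE; field; rewrite !gt_eqF.
have n20 : 0 <= eps * n ^+ 2 by rewrite mulr_ge0 ?exprn_ge0 // ltW.
by lra.
Qed.

End LocalToGlobal.

(** * Counting homomorphisms under a discrepancy bound *)

Section EdgeLists.
Variable H : sgraph.

Definition edge_list (E : seq (H * H)) : bool :=
  uniq E && all (fun e => (e.1 != e.2) && ((e.2, e.1) \notin E)) E.

(** Every edge in exactly one orientation, so that edges can be removed one by one by induction on
    the list. *)
Definition lists_edges (E : seq (H * H)) : Prop :=
  edge_list E /\ forall u v, adj u v = ((u, v) \in E) || ((v, u) \in E).

Lemma edge_list_exists : exists E, lists_edges E.
Proof.
exists [seq e : H * H <- index_enum (H * H)%type |
  adj e.1 e.2 && (enum_rank e.1 < enum_rank e.2)%N].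
split; first (apply/andP; split).
- by rewrite filter_uniq // index_enum_uniq.
- apply/allP => -[u v]; rewrite !mem_filter /= => /andP[/andP[_ uv] _].
  rewrite negb_and negb_and -leqNgt (ltnW uv) /= orbT andbT.
  by apply: contraTneq uv => ->; rewrite ltnn.
- move=> u v; rewrite !mem_filter !mem_index_enum /= !andbT [adj v u]adj_sym -andb_orr.
  case auv: (adj u v) => //=; rewrite -neq_ltn.
  by apply/esym; apply: contraTneq auv => /ord_inj/enum_rank_inj ->;
    rewrite adj_irrefl.
Qed.

Lemma set2_inj (T : finType) (a b c d : T) :
  [set a; b]%SET = [set c; d]%SET -> (a, b) = (c, d) \/ (a, b) = (d, c).
Proof.
move=> eq_set.
have E x : (x \in [set a; b]%SET) = (x \in [set c; d]%SET) by rewrite eq_set.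
have := E a; have := E b; have := E c; have := E d.
rewrite !inE !eqxx !orbT /= => /esym Ed /esym Ec Eb Ea.
case/esym/orP: Ea => /eqP ac; case/esym/orP: Eb => /eqP bc; subst a b.
- by move: Ed; rewrite orbb => /esym/eqP ->; left.
- by left.
- by right.
- by move: Ec; rewrite orbb => /esym/eqP ->; left.
Qed.

Lemma card_edges E : lists_edges E -> #|edges H| = size E.
Proof.
move=> [/andP[uE /allP sE] adjE].
pose f (e : H * H) : {set H} := [set e.1; e.2]%SET.
have uf : uniq (map f E).
  rewrite map_inj_in_uniq // => -[a b] [c d] abE cdE /set2_inj[//|[ad bc]].
  move: (sE _ abE); rewrite ad bc /= => /andP[_].
  by rewrite cdE.
rewrite -(size_map f); rewrite -(card_uniqP uf); apply: eq_card => e.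
rewrite inE; apply/existsP/mapP => [[x /existsP[y]]|[[x y] xyE ->]].
  rewrite adjE => /andP[/orP[xyE|yxE] /eqP ->]; first by exists (x, y).
  by exists (y, x) => //; rewrite /f /= finset.setUC.
by exists x; apply/existsP; exists y; rewrite adjE xyE eqxx.
Qed.

End EdgeLists.

Section MapSums.
Variables (R : realType) (H T : finType).

Definition fupd (f : {ffun H -> T}) (u : H) (x : T) : {ffun H -> T} :=
  [ffun h => if h == u then x else f h].

(** Exchanging [x] with [f u] is an involution on the pairs [(f, x)]. *)
Lemma sum_fupd (F : {ffun H -> T} -> R) u :
  \sum_f \sum_x F (fupd f u x) = #|T|%:R * \sum_f F f.
Proof.
rewrite pair_bigA /=.
pose J (q : {ffun H -> T} * T) := (fupd q.1 u q.2, q.1 u).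
have JK : involutive J.
  move=> [f x]; rewrite /J /=; congr (_, _); last by rewrite ffunE eqxx.
  by apply/ffunP => h; rewrite !ffunE; case: eqP => // ->.
transitivity (\sum_(q : {ffun H -> T} * T) F q.1).
  by rewrite [RHS](reindex_inj (inv_inj JK)).
rewrite -(pair_bigA _ (fun f _ => F f)) /= mulr_sumr.
by apply: eq_bigr => f _; rewrite sum_cst.
Qed.

(** Resampling the values at [u] and [v] stands in for fixing all other values, so the space of maps
    need not be written as a product. *)
Lemma sum_maps_le (g : {ffun H -> T} -> R) u v (M : R) : (0 < #|T|)%N ->
  (forall f, `|\sum_x \sum_y g (fupd (fupd f u x) v y)| <= M * #|T|%:R ^+ 2) ->
  `|\sum_f g f| <= M * #|T|%:R ^+ #|H|.
Proof.
move=> T0 gM; set n : R := #|T|%:R; have n0 : 0 < n by rewrite ltr0n.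
have n20 : 0 < n ^+ 2 by rewrite exprn_gt0.
have e : n ^+ 2 * \sum_f g f =
    \sum_f \sum_x \sum_y g (fupd (fupd f u x) v y).
  by rewrite (sum_fupd (fun f => \sum_y g (fupd f v y)) u) sum_fupd mulrA expr2.
rewrite -(ler_pM2l n20) -[X in X * _](ger0_norm (ltW n20)) -normrM e.
apply: le_trans (ler_norm_sum _ _ _) _.
apply: le_trans (ler_sum _ (fun f _ => gM f)) _.
rewrite sumr_const card_ffun -[_ *+ (_ ^ _)]mulr_natl natrX -/n.
by apply: eq_ler; ring.
Qed.

Lemma sum_collision u v : u != v -> (0 < #|T|)%N ->
  \sum_(f : {ffun H -> T}) (f u == f v)%:R = #|T|%:R ^+ #|H| / #|T|%:R :> R.
Proof.
move=> uv T0; have n0 : #|T|%:R != 0 :> R by rewrite pnatr_eq0 -lt0n.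
apply: (mulfI n0); rewrite -(sum_fupd (fun f => (f u == f v)%:R) u).
rewrite mulrCA mulfV // mulr1.
under eq_bigr => f _.
  under eq_bigr => x _ do rewrite !ffunE eqxx eq_sym [v == u]eq_sym (negbTE uv) eq_sym.
  rewrite sum_eq1.
  over.
by rewrite sumr_const card_ffun natrX.
Qed.

Lemma sum_noninj_le : (0 < #|T|)%N ->
  \sum_(f : {ffun H -> T}) (~~ injectiveb f)%:R <=
  #|H|%:R ^+ 2 / #|T|%:R * #|T|%:R ^+ #|H| :> R.
Proof.
move=> T0.
apply: le_trans (_ : \sum_(f : {ffun H -> T}) \sum_(u : H) \sum_(v : H)
    (if u != v then (f u == f v)%:R else 0) <= _).
  apply: ler_sum => f _.
  have nn u v : 0 <= (if u != v then (f u == f v)%:R else 0) :> R.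
    by case: ifP.
  have [inj|/injectivePn[u [v uv fuv]]] := boolP (injectiveb f).
    by apply: sumr_ge0 => u _; apply: sumr_ge0 => v _; exact: nn.
  have t1 : (if u != v then (f u == f v)%:R else 0) = 1 :> R.
    by rewrite uv fuv eqxx.
  rewrite (bigD1 u) //= (bigD1 v) //= t1 -addrA lerDl.
  apply: addr_ge0; first by apply: sumr_ge0 => w _; exact: nn.
  by apply: sumr_ge0 => w _; apply: sumr_ge0 => w' _; exact: nn.
rewrite exchange_big /=.
have -> : #|H|%:R ^+ 2 / #|T|%:R * #|T|%:R ^+ #|H| =
    \sum_(u : H) \sum_(v : H) (#|T|%:R ^+ #|H| / #|T|%:R : R).
  by rewrite !sum_cst; ring.
apply: ler_sum => u _; rewrite exchange_big /=; apply: ler_sum => v _.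
have [uv|uv] := boolP (u != v); first by rewrite sum_collision.
by rewrite big1 // divr_ge0 // exprn_ge0.
Qed.

Lemma natr_forall (P : pred H) : [forall h, P h]%:R = \prod_h (P h)%:R :> R.
Proof.
have [/forallP all1|/forallPn[h hP]] := boolP [forall h, P h].
  by rewrite big1 // => h _; rewrite all1.
by rewrite (bigD1 h) //= (negbTE hP) mul0r.
Qed.

End MapSums.

Section Counting.
Variables (R : realType) (H T : finType) (A : rel T) (p eps : R).
Variable U : H -> {set T}.
Hypothesis T0 : (0 < #|T|)%N.
Hypothesis p01 : 0 <= p <= 1.
Hypothesis Adisc : disc A p eps.

Definition good_map (E : seq (H * H)) (f : {ffun H -> T}) : bool :=
  all (fun e => A (f e.1) (f e.2)) E && [forall h, f h \in U h].

Definition map_count (E : seq (H * H)) : R := \sum_f (good_map E f)%:R.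

Lemma map_count_nil : map_count [::] = \prod_h #|U h|%:R.
Proof.
under [RHS]eq_bigr => h _ do rewrite -sum_ind.
rewrite bigA_distr_bigA; apply: eq_bigr => f _.
by rewrite /good_map /= natr_forall.
Qed.

(* With the images of all other vertices fixed, the constraints split into one
   on the image of [u] and one on the image of [v]. *)
Lemma map_count_cons u v E : u != v -> (u, v) \notin E -> (v, u) \notin E ->
  `|map_count ((u, v) :: E) - p * map_count E| <= eps * #|T|%:R ^+ #|H|.
Proof.
move=> uv uvE vuE.
have -> : map_count ((u, v) :: E) - p * map_count E =
    \sum_(f : {ffun H -> T}) ((A (f u) (f v))%:R - p) * (good_map E f)%:R.
  rewrite /map_count mulr_sumr -sumrB; apply: eq_bigr => f _.
  by rewrite /good_map /= -andbA -mulnb natrM mulrBl.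
apply: (sum_maps_le (u := u) (v := v)) => // f.
(* Edges avoiding [v] constrain [x], edges meeting [v] constrain [y]. The latter miss [u], since the
   pair [u], [v] is in [E] in neither direction. *)
pose free (e : H * H) := (e.1 != v) && (e.2 != v).
pose X : {set T} := [set x | [forall h, (h != v) ==> (fupd f u x h \in U h)] &&
  all (fun e => free e ==> A (fupd f u x e.1) (fupd f u x e.2)) E]%SET.
pose Y : {set T} := [set y | (y \in U v) &&
  all (fun e => ~~ free e ==> A (fupd f v y e.1) (fupd f v y e.2)) E]%SET.
have fx x y h : h != v -> fupd (fupd f u x) v y h = fupd f u x h.
  by move=> hv; rewrite ffunE (negbTE hv).
have fy x y h : h != u -> fupd (fupd f u x) v y h = fupd f v y h.
  by move=> hu; rewrite !ffunE (negbTE hu).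
have notu e : e \in E -> ~~ free e -> (e.1 != u) && (e.2 != u).
  case: e => a b abE; rewrite /free /= negb_and !negbK.
  by case/orP => /eqP e; move: abE; rewrite e => abE; apply/andP; split;
    rewrite ?[v == u]eq_sym //; apply: contraTneq abE => ->.
have split_good x y :
    good_map E (fupd (fupd f u x) v y) = (x \in X) && (y \in Y).
  rewrite /good_map !inE.
  apply/andP/andP => [[/allP gE /forallP gU]|].
    split; apply/andP; split.
    - by apply/forallP => h; apply/implyP => hv; rewrite -(fx x y) // gU.
    - apply/allP => e eE; apply/implyP => /andP[e1 e2].
      by rewrite -!(fx x y) // gE.
    - by have := gU v; rewrite ffunE eqxx.
    - apply/allP => e eE; apply/implyP => fe.
      by have /andP[e1 e2] := notu e eE fe; rewrite -!(fy x y) // gE.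
  move=> [/andP[/forallP xU /allP xE] /andP[yU /allP yE]]; split.
    apply/allP => e eE; have [fe|fe] := boolP (free e).
      have /andP[e1 e2] := fe; rewrite !fx //.
      by have := xE e eE; rewrite fe.
    have /andP[e1 e2] := notu e eE fe; rewrite !fy //.
    by have := yE e eE; rewrite fe.
  apply/forallP => h; have [->|hv] := eqVneq h v; first by rewrite ffunE eqxx.
  by rewrite fx //; have := xU h; rewrite hv.
apply: le_trans (Adisc X Y); apply: eq_ler; congr `|_|.
apply: eq_bigr => x _; apply: eq_bigr => y _.
rewrite split_good /ind -mulnb natrM; congr ((_%:R - _) * _).
by rewrite fx // ![fupd _ _ _ _]ffunE !eqxx.
Qed.

Lemma map_count_le E :
  uniq E -> all (fun e => (e.1 != e.2) && ((e.2, e.1) \notin E)) E ->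
  `|map_count E - p ^+ size E * \prod_h #|U h|%:R| <=
  (size E)%:R * eps * #|T|%:R ^+ #|H|.
Proof.
have /andP[p0 p1] := p01.
elim: E => [_ _|[u v] E IH] /=.
  by rewrite map_count_nil expr0 mul1r subrr normr0 !mul0r.
move=> /andP[uvE uE] /andP[/andP[uv]]; rewrite inE negb_or => /andP[_ vuE] allE.
have {}allE : all (fun e => (e.1 != e.2) && ((e.2, e.1) \notin E)) E.
  apply: sub_all allE => e /andP[-> /=].
  by rewrite inE negb_or => /andP[].
have s1 := map_count_cons uv uvE vuE.
have s2 := IH uE allE.
have -> : map_count ((u, v) :: E) - p ^+ (size E).+1 * \prod_h #|U h|%:R =
    (map_count ((u, v) :: E) - p * map_count E) +
    p * (map_count E - p ^+ size E * \prod_h #|U h|%:R).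
  by rewrite exprS; ring.
rewrite -natr1 2!mulrDl mul1r [leRHS]addrC; apply: norm_add_le s1 _.
rewrite normrM (ger0_norm p0); apply: le_trans s2.
by rewrite ler_piMl.
Qed.

End Counting.

Lemma inj_hom_map_count (R : realType) (H G : sgraph) (U : H -> {set G}) E :
  (0 < #|G|)%N -> lists_edges E ->
  `|#|[set f in inj_homs H G | [forall h, f h \in U h]]%SET|%:R -
    map_count R (@adj G) U E| <=
  #|H|%:R ^+ 2 / #|G|%:R * #|G|%:R ^+ #|H|.
Proof.
move=> G0 [/andP[uE sE] adjE]; rewrite distrC; set c := #|_|%:R.
have homE f : [forall x, forall y, @adj H x y ==> @adj G (f x) (f y)] =
    all (fun e => @adj G (f e.1) (f e.2)) E.
  apply/forallP/allP => [h [u v] uvE|h x].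
    by have /forallP/(_ v)/implyP := h u; apply; rewrite adjE uvE.
  apply/forallP => y; apply/implyP; rewrite adjE => /orP[/h//|/h /=].
  by rewrite adj_sym.
have -> : c = \sum_(f : {ffun H -> G})
    (injectiveb f && good_map (@adj G) U E f)%:R.
  rewrite /c -sum_ind; apply: eq_bigr => f _.
  by rewrite /ind !inE homE /good_map andbA.
rewrite -sumrB; apply: le_trans (ler_norm_sum _ _ _) _.
apply: le_trans (sum_noninj_le R H G0); apply: ler_sum => f _.
by case: (injectiveb f); case: (good_map _ _ _ _);
  rewrite /= ?subrr ?normr0 ?subr0 ?normr1.
Qed.

(** Used twice: with full sets for [quasi_random], and with prescribed sets for the counts of
    [F]. *)
Lemma hom_count_le (R : realType) (H G : sgraph) (p eps : R)
    (U : H -> {set G}) : (0 < #|G|)%N -> 0 <= p <= 1 -> disc (@adj G) p eps ->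
  `|#|[set f in inj_homs H G | [forall h, f h \in U h]]%SET|%:R -
    p ^+ #|edges H| * \prod_h #|U h|%:R| <=
  (#|edges H|%:R * eps + #|H|%:R ^+ 2 / #|G|%:R) * #|G|%:R ^+ #|H|.
Proof.
move=> G0 p01 Gdisc; have [E LE] := edge_list_exists H.
have [/andP[uE sE] adjE] := LE; rewrite (card_edges LE).
have cnt := map_count_le U G0 p01 Gdisc uE sE.
rewrite mulrDl; set c := #|_|%:R.
have -> : c - p ^+ size E * \prod_h #|U h|%:R =
    (map_count R (@adj G) U E - p ^+ size E * \prod_h #|U h|%:R) +
    (c - map_count R (@adj G) U E) by ring.
exact: norm_add_le cnt (inj_hom_map_count R U G0 LE).
Qed.

Lemma nhom_setT (H G : sgraph) : nhom H G =
  #|[set f in inj_homs H G | [forall h : H, f h \in [set: G]%SET]]%SET|.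
Proof.
apply: eq_card => f; rewrite [RHS]inE; apply/esym.
by rewrite andb_idr // => _; apply/forallP => h; rewrite inE.
Qed.

(** * Discrepancy from edge and 4-cycle densities *)

Section CutNorm.
Variables (R : realType) (T : finType) (A : rel T) (p eta : R).
Hypothesis T0 : (0 < #|T|)%N.
Hypothesis Asym : symmetric A.
Hypothesis p01 : 0 <= p <= 1.
Hypothesis eta01 : 0 < eta <= 1.

Let n : R := #|T|%:R.
Let a (x y : T) : R := (A x y)%:R.

Hypothesis edge_density : `|\sum_x \sum_y a x y - p * n ^+ 2| <= eta ^+ 2 * n ^+ 2.
Hypothesis C4_density : \sum_y \sum_y' (\sum_x a x y * a x y') ^+ 2 <=
  (p ^+ 4 + eta ^+ 2) * n ^+ 4.

Let c (y y' : T) : R := \sum_x a x y * a x y'.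
Let d (y : T) : R := \sum_x a x y.
Let D : R := \sum_y d y.
Let X : R := \sum_y d y ^+ 2.
Let q (y y' : T) : R := c y y' - p ^+ 2 * n.
Let dl (y : T) : R := d y - p * n.

Let n0 : 0 < n. Proof. by rewrite ltr0n. Qed.

Lemma edges_ge : (p - eta ^+ 2) * n ^+ 2 <= D.
Proof.
have -> : D = \sum_x \sum_y a x y by rewrite /D /d exchange_big.
by move: edge_density; rewrite ler_norml => /andP[h _]; lra.
Qed.

Lemma sum_codegree : \sum_y \sum_y' c y y' = X.
Proof.
rewrite /c /X.
under eq_bigr do rewrite exchange_big /=.
rewrite exchange_big /=; apply: eq_bigr => x _.
have -> : d x = \sum_y a x y by apply: eq_bigr => y _; rewrite /a Asym.
rewrite expr2 mulr_suml; apply: eq_bigr => y _.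
by rewrite mulr_sumr.
Qed.

(** Cauchy-Schwarz over the vertices, [D ^ 2 <= n * X], with the lower bound on the number of
    edges. *)
Lemma degree_sq_ge : (p ^+ 2 - 2 * eta ^+ 2) * n ^+ 3 <= X.
Proof.
have cs := sum_sqr_le d (fun=> 1).
have s1 : \sum_(y : T) (1 : R) ^+ 2 = n by rewrite expr1n sum_card1.
have s2 : \sum_y d y * 1 = D by apply: eq_bigr => y _; rewrite mulr1.
rewrite s1 s2 -/X in cs.
rewrite -(ler_pM2r n0); apply: le_trans cs.
have -> : D = p * n ^+ 2 + (D - p * n ^+ 2) by ring.
set t := D - p * n ^+ 2.
have /andP[p0 p1] := p01.
have n20 : 0 < n ^+ 2 by rewrite exprn_gt0.
have tle : - (eta ^+ 2 * n ^+ 2) <= t by have := edges_ge; rewrite /t; lra.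
have t2 : 0 <= t ^+ 2 by exact: sqr_ge0.
have e2 : 0 <= eta ^+ 2 by exact: sqr_ge0.
have pt : - (eta ^+ 2 * n ^+ 2) <= p * t.
  have [t0|t0] := leP 0 t.
    apply: le_trans (mulr_ge0 p0 t0); rewrite oppr_le0 mulr_ge0 //; exact: ltW.
  by apply: le_trans tle _; rewrite ler_niMl // ltW.
have : n ^+ 2 * - (eta ^+ 2 * n ^+ 2) <= n ^+ 2 * (p * t).
  by rewrite ler_pM2l.
have -> : (p * n ^+ 2 + t) ^+ 2 =
  p ^+ 2 * n ^+ 4 + 2 * (n ^+ 2 * (p * t)) + t ^+ 2 by ring.
have -> : (p ^+ 2 - 2 * eta ^+ 2) * n ^+ 3 * n =
  p ^+ 2 * n ^+ 4 + 2 * (n ^+ 2 * - (eta ^+ 2 * n ^+ 2)) by ring.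
lra.
Qed.

(** [X] is the total codegree, so Cauchy-Schwarz over pairs bounds [X ^ 2] by [n ^ 2] times the
    4-cycle count. Taking the root turns the error [eta ^ 2] into [eta]. *)
Lemma degree_sq_le : X <= (p ^+ 2 + eta) * n ^+ 3.
Proof.
have cs := sum2_sqr_le c (fun _ _ => 1).
have s1 : \sum_(y : T) \sum_(y' : T) (1 : R) ^+ 2 = n ^+ 2.
  by rewrite expr1n !sum_cst mulr1 expr2.
have s2 : \sum_y \sum_y' c y y' * 1 = X.
  by rewrite -sum_codegree; apply: eq_bigr => y _; apply: eq_bigr => y' _;
    rewrite mulr1.
rewrite s1 s2 in cs.
have /andP[e0 e1] := eta01.
have X0 : 0 <= X by apply: sumr_ge0 => y _; exact: sqr_ge0.
have n30 : 0 < n ^+ 3 by rewrite exprn_gt0.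
have r0 : 0 <= (p ^+ 2 + eta) * n ^+ 3.
  by rewrite mulr_ge0 ?addr_ge0 ?sqr_ge0 // ltW.
rewrite -(@ler_pXn2r _ 2) ?nnegrE //; apply: le_trans cs _.
apply: le_trans (ler_wpM2r (sqr_ge0 n) C4_density) _.
have -> : (p ^+ 4 + eta ^+ 2) * n ^+ 4 * n ^+ 2 =
  (p ^+ 4 + eta ^+ 2) * n ^+ 6 by ring.
have -> : ((p ^+ 2 + eta) * n ^+ 3) ^+ 2 = (p ^+ 2 + eta) ^+ 2 * n ^+ 6 by ring.
rewrite ler_wpM2r ?exprn_ge0 ?(ltW n0) //.
have : 0 <= p ^+ 2 * eta by rewrite mulr_ge0 ?sqr_ge0 // ltW.
have -> : (p ^+ 2 + eta) ^+ 2 = p ^+ 4 + 2 * (p ^+ 2 * eta) + eta ^+ 2 by ring.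
lra.
Qed.

(** Expanding the square leaves the 4-cycle count, bounded above, and the total codegree with
    negative sign, bounded below; the three main terms in [p ^ 4] cancel. *)
Lemma codegree_variance : \sum_y \sum_y' q y y' ^+ 2 <= 5 * eta * n ^+ 4.
Proof.
have /andP[e0 e1] := eta01; have /andP[p0 p1] := p01.
have -> : \sum_y \sum_y' q y y' ^+ 2 = \sum_y \sum_y' c y y' ^+ 2
    - 2 * p ^+ 2 * n * X + p ^+ 4 * n ^+ 4.
  have -> : p ^+ 4 * n ^+ 4 = \sum_(y : T) \sum_(y' : T) p ^+ 4 * n ^+ 2.
    by rewrite !sum_cst -/n; ring.
  rewrite -sum_codegree mulr_sumr -sumrB -big_split /=; apply: eq_bigr => y _.
  rewrite mulr_sumr -sumrB -big_split /=; apply: eq_bigr => y' _.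
  by rewrite /q; ring.
have h := degree_sq_ge.
have np : 0 <= 2 * p ^+ 2 * n by rewrite !mulr_ge0 ?sqr_ge0 // ltW.
have h2 := ler_wpM2l np h.
have p2 : p ^+ 2 <= 1 by rewrite exprn_ile1.
have e2 : eta ^+ 2 <= eta by rewrite expr2 ler_piMl // ltW.
have e20 : 0 <= eta ^+ 2 by exact: sqr_ge0.
have n40 : 0 <= n ^+ 4 by rewrite exprn_ge0 // ltW.
have pe : p ^+ 2 * eta ^+ 2 <= eta ^+ 2 by rewrite ler_piMl.
have : (eta ^+ 2 + 4 * (p ^+ 2 * eta ^+ 2)) * n ^+ 4 <= 5 * eta * n ^+ 4.
  by rewrite ler_wpM2r //; lra.
have -> : (eta ^+ 2 + 4 * (p ^+ 2 * eta ^+ 2)) * n ^+ 4 =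
  (p ^+ 4 + eta ^+ 2) * n ^+ 4 - 2 * p ^+ 2 * n *
    ((p ^+ 2 - 2 * eta ^+ 2) * n ^+ 3) + p ^+ 4 * n ^+ 4 by ring.
by have := C4_density; rewrite -/c; lra.
Qed.

Lemma degree_variance : \sum_y dl y ^+ 2 <= 3 * eta * n ^+ 3.
Proof.
have /andP[e0 e1] := eta01; have /andP[p0 p1] := p01.
have -> : \sum_y dl y ^+ 2 = X - 2 * p * n * D + p ^+ 2 * n ^+ 3.
  have -> : p ^+ 2 * n ^+ 3 = \sum_(y : T) p ^+ 2 * n ^+ 2.
    by rewrite sum_cst -/n; ring.
  rewrite /X /D mulr_sumr -sumrB -big_split /=; apply: eq_bigr => y _.
  by rewrite /dl; ring.
have np : 0 <= 2 * p * n by rewrite !mulr_ge0 // ltW.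
have h := degree_sq_le; have h2 := ler_wpM2l np edges_ge.
have e2 : eta ^+ 2 <= eta by rewrite expr2 ler_piMl // ltW.
have pe : p * eta ^+ 2 <= eta ^+ 2 by rewrite ler_piMl // sqr_ge0.
have n30 : 0 <= n ^+ 3 by rewrite exprn_ge0 // ltW.
have : (eta + 2 * (p * eta ^+ 2)) * n ^+ 3 <= 3 * eta * n ^+ 3.
  by rewrite ler_wpM2r //; lra.
have -> : (eta + 2 * (p * eta ^+ 2)) * n ^+ 3 = (p ^+ 2 + eta) * n ^+ 3 -
   2 * p * n * ((p - eta ^+ 2) * n ^+ 2) + p ^+ 2 * n ^+ 3 by ring.
lra.
Qed.

Let m (x y : T) : R := a x y - p.
Let cm (y y' : T) : R := \sum_x m x y * m x y'.

(** [cm] is the centred codegree corrected by two centred degrees. The square of three terms costs a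
    factor [3], whence [33 = 3 * 5 + 6 * 3]. *)
Lemma centered_codegree_sq : \sum_y \sum_y' cm y y' ^+ 2 <= 33 * eta * n ^+ 4.
Proof.
have /andP[e0 e1] := eta01; have /andP[p0 p1] := p01.
have cmE y y' : cm y y' = q y y' - p * dl y - p * dl y'.
  have -> : q y y' - p * dl y - p * dl y' =
      c y y' - p * d y - p * d y' + n * p ^+ 2 by rewrite /q /dl; ring.
  rewrite -sum_cst /c /d !mulr_sumr -!sumrB -big_split /=.
  by apply: eq_bigr => x _; rewrite /m; ring.
apply: le_trans (_ : \sum_y \sum_y' (3 * q y y' ^+ 2 + 3 * dl y ^+ 2 +
    3 * dl y' ^+ 2) <= _).
  apply: ler_sum => y _; apply: ler_sum => y' _; rewrite cmE.
  set u := q y y'; set v := dl y; set w := dl y'.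
  have p2 : p ^+ 2 <= 1 by rewrite exprn_ile1.
  have pv : (p * v) ^+ 2 <= v ^+ 2 by rewrite exprMn ler_piMl // sqr_ge0.
  have pw : (p * w) ^+ 2 <= w ^+ 2 by rewrite exprMn ler_piMl // sqr_ge0.
  have := sqr_ge0 (u + p * v); have := sqr_ge0 (u + p * w).
  have := sqr_ge0 (p * v - p * w).
  move: pv pw; move: (p * v) (p * w) => v' w'; nra.
have -> : \sum_y \sum_y' (3 * q y y' ^+ 2 + 3 * dl y ^+ 2 + 3 * dl y' ^+ 2) =
    3 * (\sum_y \sum_y' q y y' ^+ 2) + 6 * n * \sum_y dl y ^+ 2.
  have e3 : 3 * n * \sum_y dl y ^+ 2 = \sum_y \sum_(y' : T) 3 * dl y ^+ 2.
    by rewrite mulr_sumr; apply: eq_bigr => y _; rewrite sum_cst -/n; ring.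
  have e4 : 3 * n * \sum_y dl y ^+ 2 = \sum_(y : T) \sum_y' 3 * dl y' ^+ 2.
    by rewrite sum_cst -mulr_sumr -/n; ring.
  have -> : 6 * n * \sum_y dl y ^+ 2 =
    3 * n * (\sum_y dl y ^+ 2) + 3 * n * (\sum_y dl y ^+ 2) by ring.
  rewrite addrA {1}e3 e4 mulr_sumr -!big_split /=; apply: eq_bigr => y _.
  by rewrite mulr_sumr -!big_split.
have h1 := codegree_variance.
have n60 : 0 <= 6 * n by rewrite mulr_ge0 // ltW.
have h2 := ler_wpM2l n60 degree_variance.
have e5 : 6 * n * (3 * eta * n ^+ 3) = 18 * eta * n ^+ 4 by ring.
rewrite e5 in h2; lra.
Qed.

(** A first Cauchy-Schwarz over [x] removes [U], a second over pairs [y], [y'] removes [V]. *)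
Lemma cut_norm_le (U V : {set T}) :
  (\sum_x \sum_y m x y * (ind R U x * ind R V y)) ^+ 4 <= 33 * eta * n ^+ 8.
Proof.
set S := \sum_x _.
have ind2 (W : {set T}) x : ind R W x ^+ 2 <= 1.
  by have /andP[i0 i1] := ind_itv R W x; rewrite exprn_ile1.
have S2 : S ^+ 2 <= n * \sum_y \sum_y' cm y y' * (ind R V y * ind R V y').
  have -> : S = \sum_x ind R U x * \sum_y m x y * ind R V y.
    apply: eq_bigr => x _; rewrite mulr_sumr; apply: eq_bigr => y _; ring.
  apply: le_trans (sum_sqr_le _ _) _.
  have -> : \sum_y \sum_y' cm y y' * (ind R V y * ind R V y') =
      \sum_x (\sum_y m x y * ind R V y) ^+ 2.
    rewrite /cm; under eq_bigr => y _.
      under eq_bigr => y' _ do rewrite mulr_suml.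
      rewrite exchange_big /=.
      over.
    rewrite exchange_big /=; apply: eq_bigr => x _.
    rewrite expr2 mulr_suml; apply: eq_bigr => y _; rewrite mulr_sumr.
    by apply: eq_bigr => y' _; ring.
  apply: ler_wpM2r; first by apply: sumr_ge0 => x _; exact: sqr_ge0.
  by rewrite /n -sum_card1; apply: ler_sum.
have /andP[e0 e1] := eta01.
have -> : S ^+ 4 = (S ^+ 2) ^+ 2 by rewrite -exprM.
set B := \sum_y \sum_y' cm y y' * (ind R V y * ind R V y') in S2.
have B2 : B ^+ 2 <= 33 * eta * n ^+ 6.
  apply: le_trans (sum2_sqr_le _ _) _.
  have -> : 33 * eta * n ^+ 6 = 33 * eta * n ^+ 4 * n ^+ 2 by ring.
  apply: ler_pM centered_codegree_sq _.
  - by apply: sumr_ge0 => y _; apply: sumr_ge0 => y' _; exact: sqr_ge0.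
  - by apply: sumr_ge0 => y _; apply: sumr_ge0 => y' _; exact: sqr_ge0.
  have -> : n ^+ 2 = \sum_(y : T) \sum_(y' : T) (1 : R).
    by rewrite !sum_cst mulr1 expr2.
  apply: ler_sum => y _; apply: ler_sum => y' _; rewrite exprMn.
  by rewrite mulr_ile1 ?sqr_ge0.
apply: le_trans (_ : (n * B) ^+ 2 <= _).
  rewrite ler_pXn2r ?nnegrE ?sqr_ge0 //; exact: le_trans (sqr_ge0 _) S2.
have -> : 33 * eta * n ^+ 8 = n ^+ 2 * (33 * eta * n ^+ 6) by ring.
by rewrite exprMn ler_wpM2l ?sqr_ge0.
Qed.

Lemma disc_of_densities (eps : R) : 0 <= eps -> 33 * eta <= eps ^+ 4 ->
  disc A p eps.
Proof.
move=> eps0 eta_le U V; rewrite -/n.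
have en : 0 <= eps * n ^+ 2 by rewrite mulr_ge0 ?sqr_ge0.
rewrite -(@ler_pXn2r _ 4) ?nnegrE //.
have -> : (eps * n ^+ 2) ^+ 4 = eps ^+ 4 * n ^+ 8 by ring.
rewrite -normrX ger0_norm; last by rewrite (exprM _ 2 2) sqr_ge0.
apply: le_trans (cut_norm_le U V) _.
by rewrite ler_wpM2r // exprn_ge0 // ltW.
Qed.

End CutNorm.

(** * The edge and the 4-cycle *)

Section SmallGraphs.

Lemma K2_sym : symmetric (fun x y : bool => x != y).
Proof. by case; case. Qed.

Lemma K2_irrefl : irreflexive (fun x y : bool => x != y).
Proof. by case. Qed.

Definition K2 : sgraph := SGraph K2_sym K2_irrefl.

Lemma C4_sym : symmetric (fun x y : bool * bool => x.1 != y.1).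
Proof. by move=> x y; rewrite eq_sym. Qed.

Lemma C4_irrefl : irreflexive (fun x y : bool * bool => x.1 != y.1).
Proof. by move=> x; rewrite eqxx. Qed.

(** The 4-cycle as the complete bipartite graph with two vertices on each side; the first coordinate
    is the side. *)
Definition C4 : sgraph := SGraph C4_sym C4_irrefl.

Definition K2_edges : seq (K2 * K2) := [:: (true, false)].

Definition C4_edges : seq (C4 * C4) :=
  [:: ((true, true), (false, true)); ((true, true), (false, false));
      ((true, false), (false, true)); ((true, false), (false, false))].

Lemma K2_lists_edges : lists_edges K2_edges.
Proof. by split=> // -[] []. Qed.

Lemma C4_lists_edges : lists_edges C4_edges.
Proof. by split=> // -[[] []] [[] []]. Qed.

Lemma all_mapsT (R : realType) (H G : sgraph) E :
  map_count R (@adj G) (fun _ : H => [set: G]%SET) E =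
  \sum_(f : {ffun H -> G}) (all (fun e => adj (f e.1) (f e.2)) E)%:R.
Proof.
apply: eq_bigr => f _; rewrite /good_map andb_idr // => _.
by apply/forallP => h; rewrite inE.
Qed.

Lemma K2_map_count (R : realType) (G : sgraph) :
  map_count R (@adj G) (fun _ : K2 => [set: G]%SET) K2_edges =
  \sum_(x : G) \sum_(y : G) (adj x y)%:R.
Proof.
rewrite all_mapsT pair_bigA /=.
pose h (q : G * G) : {ffun K2 -> G} :=
  [ffun b : K2 => if (b : bool) then q.1 else q.2].
have bij_h : bijective h.
  exists (fun f : {ffun K2 -> G} => (f true, f false)).
    by case=> x y; rewrite /h !ffunE.
  by move=> f; apply/ffunP => -[]; rewrite ffunE.
rewrite (reindex h) /=; last exact: onW_bij.
by apply: eq_bigr => q _; rewrite !ffunE andbT.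
Qed.

Lemma C4_map_count (R : realType) (G : sgraph) :
  map_count R (@adj G) (fun _ : C4 => [set: G]%SET) C4_edges =
  \sum_(y : G) \sum_(y' : G)
    (\sum_(x : G) (adj x y)%:R * (adj x y')%:R) ^+ 2.
Proof.
have -> : \sum_(y : G) \sum_(y' : G)
    (\sum_(x : G) (adj x y)%:R * (adj x y')%:R) ^+ 2 =
  \sum_(y : G) \sum_(y' : G) \sum_(x : G) \sum_(x' : G)
    [&& adj x y, adj x y', adj x' y & adj x' y']%:R :> R.
  apply: eq_bigr => y _; apply: eq_bigr => y' _.
  rewrite expr2 mulr_suml; apply: eq_bigr => x _.
  rewrite mulr_sumr; apply: eq_bigr => x' _.
  by rewrite -!natrM !mulnb -andbA.
rewrite all_mapsT !pair_bigA /=.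
pose h (q : G * G * G * G) : {ffun C4 -> G} := [ffun b : C4 =>
  if b.1 then (if b.2 then q.1.2 else q.2)
  else (if b.2 then q.1.1.1 else q.1.1.2)].
have bij_h : bijective h.
  exists (fun f : {ffun C4 -> G} =>
    (f (false, true), f (false, false), f (true, true), f (true, false))).
    by case=> [[[y y'] x] x']; rewrite /h !ffunE.
  by move=> f; apply/ffunP => -[[] []]; rewrite ffunE.
rewrite (reindex h) /=; last exact: onW_bij.
by apply: eq_bigr => q _; rewrite !ffunE andbT.
Qed.

End SmallGraphs.

(** * Quasi-randomness and small discrepancy are equivalent *)

Section QuasiRandomDisc.
Local Open Scope classical_set_scope.
Variables (R : realType) (G : nat -> sgraph) (p : R).
Hypothesis Ginf : order_to_infty G.
Hypothesis p01 : 0 <= p <= 1.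

Lemma order_near (N : nat) : \forall n \near \oo, (N < #|G n|)%N.
Proof. by move/cvgnyPgt: Ginf; exact. Qed.

Lemma order_near_inv (c eps : R) : 0 <= c -> 0 < eps ->
  \forall n \near \oo, c / #|G n|%:R <= eps.
Proof.
move=> c0 eps0; near=> n.
have G0 : (0 < #|G n|)%N by near: n; exact: order_near.
rewrite ler_pdivrMr ?ltr0n // mulrC -ler_pdivrMr //.
apply: ltW; apply: lt_trans (archi_boundP _) _; first by rewrite divr_ge0 // ltW.
rewrite ltr_nat; near: n; exact: order_near.
Unshelve. all: by end_near. Qed.

Lemma quasi_random_of_disc :
  (forall eps : R, 0 < eps -> \forall n \near \oo, disc (@adj (G n)) p eps) ->
  quasi_random p G.
Proof.
move=> Gdisc H; apply/cvgrPdist_le => eps eps0.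
set e := #|edges H|.
(* The added [1] keeps the later quotient meaningful for graphs without edges. *)
have e10 : 0 < e%:R + 1 :> R by rewrite ltr_pwDr.
near=> n.
have G0 : (0 < #|G n|)%N by near: n; exact: order_near.
have nH0 : 0 < #|G n|%:R ^+ #|H| :> R by rewrite exprn_gt0 // ltr0n.
have dn : disc (@adj (G n)) p (eps / 2 / (e%:R + 1)).
  by near: n; apply: Gdisc; rewrite !divr_gt0.
have sn : #|H|%:R ^+ 2 / #|G n|%:R <= eps / 2 :> R.
  by near: n; apply: order_near_inv; rewrite ?sqr_ge0 ?divr_gt0.
have := hom_count_le (fun _ : H => [set: G n]%SET) G0 p01 dn.
rewrite -nhom_setT -/e.
under eq_bigr do rewrite cardsT.
rewrite prodr_const => h.
have ratio (P N k : R) : 0 < k -> P - N / k = - (N - P * k) / k.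
  by move=> k0; field; rewrite gt_eqF.
rewrite ratio // normrM normrN normfV (ger0_norm (ltW nH0)) ler_pdivrMr //.
apply: le_trans h _; rewrite ler_wpM2r ?(ltW nH0) //.
have : e%:R * (eps / 2 / (e%:R + 1)) <= eps / 2.
  rewrite mulrA ler_pdivrMr // mulrC ler_pM2l ?divr_gt0 //; lra.
lra.
Unshelve. all: by end_near. Qed.

Lemma map_count_near (H : sgraph) (E : seq (H * H)) (eps : R) :
  quasi_random p G -> lists_edges E -> 0 < eps ->
  \forall n \near \oo,
  `|map_count R (@adj (G n)) (fun=> [set: G n]%SET) E -
    p ^+ size E * #|G n|%:R ^+ #|H| | <= eps * #|G n|%:R ^+ #|H|.
Proof.
move=> qr LE eps0; near=> n.
have G0 : (0 < #|G n|)%N by near: n; exact: order_near.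
have nH0 : 0 < #|G n|%:R ^+ #|H| :> R by rewrite exprn_gt0 // ltr0n.
have sn : #|H|%:R ^+ 2 / #|G n|%:R <= eps / 2 :> R.
  by near: n; apply: order_near_inv; rewrite ?sqr_ge0 ?divr_gt0.
have qn : `|p ^+ #|edges H| - (nhom H (G n))%:R / #|G n|%:R ^+ #|H| | <= eps / 2.
  by near: n; move/cvgrPdist_le: (qr H); apply; rewrite divr_gt0.
have := inj_hom_map_count R (fun _ : H => [set: G n]%SET) G0 LE.
rewrite -nhom_setT; move: qn; rewrite (card_edges LE).
set m := map_count _ _ _ _; set N := (nhom _ _)%:R; set k := _ ^+ #|H| => qn mn.
rewrite -/k in nH0.
have ratio (P : R) : m - P * k = (N / k - P) * k - (N - m).
  by rewrite mulrBl divfK ?gt_eqF //; ring.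
have -> : eps * k = eps / 2 * k + eps / 2 * k by rewrite -mulrDl -splitr.
rewrite ratio.
apply: norm_sub_le.
  by rewrite normrM (ger0_norm (ltW nH0)) ler_wpM2r ?(ltW nH0) // distrC.
by apply: le_trans mn _; rewrite ler_wpM2r // ltW.
Unshelve. all: by end_near. Qed.

Lemma disc_of_quasi_random (eps : R) : quasi_random p G -> 0 < eps ->
  \forall n \near \oo, disc (@adj (G n)) p eps.
Proof.
move=> qr eps0.
(* The fourth power comes from the two applications of Cauchy-Schwarz in [cut_norm_le]. *)
pose eta := Num.min 1 (eps ^+ 4 / 33).
have eta0 : 0 < eta by rewrite lt_min ltr01 divr_gt0 // exprn_gt0.
have eta1 : eta <= 1 by rewrite ge_min lexx.
have eta33 : 33 * eta <= eps ^+ 4.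
  by rewrite mulrC -ler_pdivlMr // ge_min lexx orbT.
have e20 : 0 < eta ^+ 2 by rewrite exprn_gt0.
have k2 := map_count_near qr K2_lists_edges e20.
have c4 := map_count_near qr C4_lists_edges e20.
near=> n.
have G0 : (0 < #|G n|)%N by near: n; exact: order_near.
apply: (disc_of_densities G0 (@adj_sym (G n)) p01 (eta := eta)).
- by rewrite eta0.
- have : `|map_count R (@adj (G n)) (fun=> [set: G n]%SET) K2_edges -
    p ^+ size K2_edges * #|G n|%:R ^+ #|K2| | <= eta ^+ 2 * #|G n|%:R ^+ #|K2|.
    by near: n.
  by rewrite K2_map_count card_bool expr1.
- have : `|map_count R (@adj (G n)) (fun=> [set: G n]%SET) C4_edges -
    p ^+ size C4_edges * #|G n|%:R ^+ #|C4| | <= eta ^+ 2 * #|G n|%:R ^+ #|C4|.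
    by near: n.
  rewrite C4_map_count card_prod card_bool /= ler_norml => /andP[_].
  by rewrite lerBlDl -mulrDl.
- exact: ltW.
- by [].
Unshelve. all: by end_near. Qed.

End QuasiRandomDisc.

(** * Graphs on three vertices *)

Section ThreeVertices.

Definition i0 : 'I_3 := ord0.
Definition i1 : 'I_3 := @Ordinal 3 1 isT.
Definition i2 : 'I_3 := @Ordinal 3 2 isT.

Lemma I3_ind (P : 'I_3 -> Prop) : P i0 -> P i1 -> P i2 -> forall i, P i.
Proof.
move=> P0 P1 P2 [[|[|[|m]]] lt_m] //.
- by rewrite (_ : Ordinal _ = i0) //; exact: val_inj.
- by rewrite (_ : Ordinal _ = i1) //; exact: val_inj.
- by rewrite (_ : Ordinal _ = i2) //; exact: val_inj.
Qed.

(** Six explicit permutations are told apart by their values; as there are only [3!] permutations,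
    the list is complete. *)
Lemma sum_S3 (R : nmodType) (Phi : 'I_3 -> 'I_3 -> 'I_3 -> R) :
  \sum_(s : 'S_3) Phi (s i0) (s i1) (s i2) =
  Phi i0 i1 i2 + Phi i0 i2 i1 + Phi i1 i0 i2 + Phi i1 i2 i0 + Phi i2 i0 i1 +
  Phi i2 i1 i0.
Proof.
pose l : seq 'S_3 := [:: 1%g; tperm i1 i2; tperm i0 i1;
  (tperm i1 i2 * tperm i0 i1)%g; (tperm i0 i1 * tperm i1 i2)%g; tperm i0 i2].
pose ev (s : 'S_3) := (s i0, s i1, s i2).
have evE : map ev l = [:: (i0, i1, i2); (i0, i2, i1); (i1, i0, i2);
    (i1, i2, i0); (i2, i0, i1); (i2, i1, i0)].
  rewrite /l /= /ev ?permM !permE /=.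
  by congr [:: _; _; _; _; _; _]; congr (_, _, _); apply: val_inj.
have ul : uniq l by apply: (@map_uniq _ _ ev); rewrite evE.
have pl : perm_eq (index_enum 'S_3) l.
  rewrite perm_sym; apply: uniq_perm => //; first exact: index_enum_uniq.
  have [||_ e] := uniq_min_size ul (s2 := index_enum 'S_3).
  - by move=> s _; rewrite mem_index_enum.
  - rewrite -(card_uniqP (index_enum_uniq _)).
    rewrite (eq_card (B := 'S_3)) ?card_Sn // => s.
    by rewrite mem_index_enum.
  by [].
rewrite (perm_big _ pl) /=.
transitivity (\sum_(t <- map ev l) Phi t.1.1 t.1.2 t.2); first by rewrite big_map.
by rewrite evE !big_cons big_nil addr0 !addrA.
Qed.

Lemma forall_I3 (P : pred 'I_3) : [forall i, P i] = [&& P i0, P i1 & P i2].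
Proof.
apply/forallP/and3P => [h|[h0 h1 h2]]; first by split.
by apply: I3_ind.
Qed.

Lemma triple_i0 (T : Type) (a b c : T) : triple a b c i0 = a.
Proof. by []. Qed.

Lemma triple_i1 (T : Type) (a b c : T) : triple a b c i1 = b.
Proof. by []. Qed.

Lemma triple_i2 (T : Type) (a b c : T) : triple a b c i2 = c.
Proof. by []. Qed.

Definition tripleE := (triple_i0, triple_i1, triple_i2).

End ThreeVertices.

Section TriangleCounts.
Variables (R : realType) (F : sgraph) (v : 'I_3 -> F).
Hypothesis hF : #|F| = 3%N.
Hypothesis hv : injective v.

Let b01 := adj (v i0) (v i1).
Let b02 := adj (v i0) (v i2).
Let b12 := adj (v i1) (v i2).

Lemma label_bij : bijective v.
Proof. by apply: inj_card_bij => //; rewrite hF card_ord. Qed.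

Lemma card_edges3 : #|edges F| = (b01 + b02 + b12)%N.
Proof.
have [g vK gK] := label_bij.
pose E := (if b01 then [:: (v i0, v i1)] else [::]) ++
  (if b02 then [:: (v i0, v i2)] else [::]) ++
  (if b12 then [:: (v i1, v i2)] else [::]).
have -> : (b01 + b02 + b12)%N = size E.
  by rewrite /E !size_cat; case: b01; case: b02; case: b12.
apply: card_edges; split.
  rewrite /edge_list /E; case: b01; case: b02; case: b12;
  by rewrite /= ?inE ?negb_or ?xpair_eqE ?(inj_eq hv).
move=> u w; rewrite -(gK u) -(gK w) /E.
elim/I3_ind: (g u); elim/I3_ind: (g w);
  rewrite ?adj_irrefl ?[adj (v i1) (v i0)]adj_sym ?[adj (v i2) (v i0)]adj_sym
    ?[adj (v i2) (v i1)]adj_sym -?/b01 -?/b02 -?/b12;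
  case: b01; case: b02; case: b12;
  by rewrite /= ?inE ?xpair_eqE ?(inj_eq hv).
Qed.

Variable G : sgraph.

Let adjR (x y : G) : R := (adj x y)%:R.

Definition labelled_hom (x y z : G) : R :=
  (distinct3 x y z)%:R * mono b01 b02 b12 adjR x y z.

Lemma nhom3_tri (U : 'I_3 -> {set G}) : (nhom3 v U)%:R =
  tri labelled_hom (ind R (U i0)) (ind R (U i1)) (ind R (U i2)).
Proof.
have [g vK gK] := label_bij.
rewrite /nhom3 -sum_ind /tri !pair_bigA /=.
pose h (q : G * G * G) : {ffun F -> G} :=
  [ffun u => triple q.1.1 q.1.2 q.2 (g u)].
have hE q i : h q (v i) = triple q.1.1 q.1.2 q.2 i by rewrite ffunE vK.
have bij_h : bijective h.
  exists (fun f : {ffun F -> G} => (f (v i0), f (v i1), f (v i2))).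
    by case=> [[x y] z]; rewrite !hE !tripleE.
  move=> f; apply/ffunP => u; rewrite -(gK u) hE.
  by elim/I3_ind: (g u); rewrite tripleE.
rewrite (reindex h) /=; last exact: onW_bij.
apply: eq_bigr => -[[x y] z] _; rewrite /ind /=.
rewrite !inE forall_I3 !hE !tripleE /=.
have injE : injectiveb (h (x, y, z)) = distinct3 x y z.
  apply/injectiveP/and3P => [inj|[xy xz yz]].
    split; apply/negP => /eqP e.
    - by have /hv : v i0 = v i1 by apply: inj; rewrite !hE !tripleE.
    - by have /hv : v i0 = v i2 by apply: inj; rewrite !hE !tripleE.
    - by have /hv : v i1 = v i2 by apply: inj; rewrite !hE !tripleE.
  move=> u w; rewrite -(gK u) -(gK w).
  elim/I3_ind: (g u); elim/I3_ind: (g w); rewrite !hE !tripleE //= => e;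
    by move: xy xz yz; rewrite e ?eqxx.
have homE : [forall u, forall w, @adj F u w ==>
    @adj G (h (x, y, z) u) (h (x, y, z) w)] =
    [&& b01 ==> adj x y, b02 ==> adj x z & b12 ==> adj y z].
  apply/forallP/and3P => [hom|[h01 h02 h12]].
    have hom' i j : adj (v i) (v j) ==> @adj G (h (x, y, z) (v i)) (h (x, y, z) (v j)).
      by have /forallP := hom (v i).
    by have := hom' i0 i1; have := hom' i0 i2; have := hom' i1 i2;
      rewrite !hE !tripleE.
  move=> u; apply/forallP => w; rewrite -(gK u) -(gK w).
  elim/I3_ind: (g u); elim/I3_ind: (g w); rewrite !hE !tripleE ?adj_irrefl //;
    by rewrite adj_sym [@adj G _ _]adj_sym.
rewrite injE homE /labelled_hom /mono !kern_adjE -!natrM !mulnb -!andbA.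
by [].
Qed.

(** Permuting the three weight functions amounts to permuting the arguments of the kernel. *)
Lemma tri_sym_sum (K : G -> G -> G -> R) (a b c : G -> R) :
  tri K a b c + tri K a c b + tri K b a c + tri K b c a + tri K c a b +
    tri K c b a =
  tri (fun x y z => K x y z + K x z y + K y x z + K y z x + K z x y + K z y x)
    a b c.
Proof.
have s23 (L : G -> G -> G -> R) d e f :
    tri L d f e = tri (fun x y z => L x z y) d e f.
  rewrite /tri; apply: eq_bigr => x _; rewrite exchange_big /=.
  by apply: eq_bigr => y _; apply: eq_bigr => z _; ring.
have s12 (L : G -> G -> G -> R) d e f :
    tri L e d f = tri (fun x y z => L y x z) d e f.
  rewrite /tri exchange_big /=; apply: eq_bigr => y _.
  by apply: eq_bigr => x _; apply: eq_bigr => z _; ring.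
rewrite (s23 K a b c) (s12 K a b c) (etrans (s23 K b a c) (s12 _ a b c)).
rewrite (etrans (s12 K a c b) (s23 _ a b c)).
rewrite (etrans (s12 K b c a) (etrans (s23 _ b a c) (s12 _ a b c))).
rewrite /tri -!big_split; apply: eq_bigr => x _ /=.
rewrite -!big_split; apply: eq_bigr => y _ /=.
by rewrite -!big_split; apply: eq_bigr => z _ /=; ring.
Qed.

(** Averaging over the six orders forgets which pairs are edges and leaves the symmetric polynomial
    of their number. An edge must exist, because [tri_poly 0] is the triangle product and not
    [1]. *)
Lemma avg_nhom3_tri (U U' : {set G}) : (0 < #|edges F|)%N ->
  avg_nhom3 R v (triple U U U') =
  tri (fun x y z => (distinct3 x y z)%:R * tri_val #|edges F| adjR x y z)
    (ind R U) (ind R U) (ind R U').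
Proof.
rewrite card_edges3 => e0.
pose t (i : 'I_3) := ind R (triple U U U' i).
rewrite /avg_nhom3; under eq_bigr => s _ do rewrite nhom3_tri.
rewrite (sum_S3 (fun i j k => tri labelled_hom (t i) (t j) (t k))).
rewrite tri_sym_sum /t !tripleE /tri mulr_sumr; apply: eq_bigr => x _.
rewrite mulr_sumr; apply: eq_bigr => y _.
rewrite mulr_sumr; apply: eq_bigr => z _.
move: (ind R U x * ind R U y * ind R U' z) => wt.
rewrite mulrA; congr (_ * _).
have dE : [/\ distinct3 x z y = distinct3 x y z, distinct3 y x z = distinct3 x y z,
    distinct3 y z x = distinct3 x y z, distinct3 z x y = distinct3 x y z &
    distinct3 z y x = distinct3 x y z].
  rewrite /distinct3 [y == x]eq_sym [z == x]eq_sym [z == y]eq_sym.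
  by split; case: (x == y); case: (x == z); case: (y == z).
case: dE => d1 d2 d3 d4 d5; rewrite /labelled_hom d1 d2 d3 d4 d5.
have aC u w : adjR u w = adjR w u by rewrite /adjR adj_sym.
rewrite /mono /tri_val /kern [adjR y x]aC [adjR z x]aC [adjR z y]aC.
by move: e0; case: b01; case: b02; case: b12 => //= _; field.
Qed.

End TriangleCounts.

(** * The local property and small discrepancy are equivalent *)

Section Equivalence.
Local Open Scope classical_set_scope.
Variables (R : realType) (F : sgraph) (v : 'I_3 -> F) (alpha beta p : R).
Hypothesis hF : #|F| = 3%N.
Hypothesis eF : (0 < #|edges F|)%N.
Hypothesis hv : injective v.
Hypothesis alpha0 : 0 < alpha.
Hypothesis beta0 : 0 < beta.
Hypothesis ab1 : alpha + beta < 1.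
Hypothesis p0 : 0 < p.
Hypothesis p1 : p <= 1.
Variable G : nat -> sgraph.
Hypothesis Ginf : order_to_infty G.

Let e := #|edges F|.

Lemma edges3_itv : (0 < e <= 3)%N.
Proof.
rewrite eF /= /e (card_edges3 hF hv).
by case: (adj _ _); case: (adj _ _); case: (adj _ _).
Qed.

Lemma pe_norm_le1 : `|p ^+ e| <= 1.
Proof. by rewrite ger0_norm ?exprn_ge0 ?exprn_ile1 // ltW. Qed.

(** On distinct triples the integrands agree; on degenerate ones only the constant [p ^+ e] is left,
    and there are at most [3 * n ^ 2] of those. *)
Lemma defect_avg_le (H : sgraph) (U U' : {set H}) :
  `|tri (defect (@adj H) e p) (ind R U) (ind R U) (ind R U') -
    (avg_nhom3 R v (triple U U U') - p ^+ e * #|U|%:R ^+ 2 * #|U'|%:R)| <=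
  3 * #|H|%:R ^+ 2.
Proof.
rewrite avg_nhom3_tri // -/e.
have -> : p ^+ e * #|U|%:R ^+ 2 * #|U'|%:R =
    tri (fun _ _ _ => p ^+ e) (ind R U) (ind R U) (ind R U').
  rewrite -(sum_ind R U) -(sum_ind R U') /tri expr2 -!mulrA mulr_suml mulr_sumr.
  apply: eq_bigr => x _; rewrite mulr_suml !mulr_sumr; apply: eq_bigr => y _.
  by rewrite !mulr_sumr; apply: eq_bigr => z _; rewrite !mulrA.
pose L (x y z : H) : R := (if distinct3 x y z then 0 else p ^+ e) *
  (ind R U x * ind R U y * ind R U' z).
have -> : tri (defect (@adj H) e p) (ind R U) (ind R U) (ind R U') -
    (tri (fun x y z => (distinct3 x y z)%:R *
       tri_val e (fun x y => (adj x y)%:R) x y z)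
       (ind R U) (ind R U) (ind R U') -
     tri (fun _ _ _ => p ^+ e) (ind R U) (ind R U) (ind R U')) =
    \sum_x \sum_y \sum_z L x y z.
  rewrite /tri -!sumrB; apply: eq_bigr => x _.
  rewrite -!sumrB; apply: eq_bigr => y _.
  rewrite -!sumrB; apply: eq_bigr => z _; rewrite /L /defect -/e.
  by move: (p ^+ e) (tri_val _ _ _ _ _) => q w;
    case: (distinct3 x y z) => /=; ring.
have L1 : \sum_x \sum_y \sum_z `|L x y z| <= 3 * #|H|%:R ^+ 2.
  apply: sum_coincidences_le => x y z; rewrite /L.
  case: (distinct3 x y z); first by rewrite mul0r normr0.
  have i1 W u := norm_itv_le1 (ind_itv R W u).
  have -> : (1 : R) = 1 * (1 * 1 * 1) by rewrite !mulr1.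
  by do ?[apply: norm_mul_le]; rewrite ?mulr1 ?pe_norm_le1 ?i1.
apply: le_trans L1.
apply: le_trans (ler_norm_sum _ _ _) _; apply: ler_sum => x _.
apply: le_trans (ler_norm_sum _ _ _) _; apply: ler_sum => y _.
exact: ler_norm_sum.
Qed.

Lemma P21_disc : P21 v alpha beta p G ->
  forall eps : R, 0 < eps -> \forall n \near \oo, disc (@adj (G n)) p eps.
Proof.
move=> P eps eps0.
have p01 : 0 < p <= 1 by rewrite p0.
have [delta [N [delta0 loc]]] :=
  disc_of_local_counts alpha0 beta0 ab1 p01 edges3_itv eps0.
(* The other half of [delta] pays for the degenerate triples. *)
have d20 : 0 < delta / 2 by rewrite divr_gt0.
have P' := P _ d20.
near=> n.
have Nn : (N < #|G n|)%N by near: n; exact: order_near.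
have n30 : 3 / #|G n|%:R <= delta / 2 by near: n; exact: order_near_inv.
have Pn : forall U U' : {set G n}, [disjoint U & U']%B ->
      #|U|%:Z = Num.floor (alpha * #|G n|%:R) ->
      #|U'|%:Z = Num.floor (beta * #|G n|%:R) ->
      `| avg_nhom3 R v (triple U U U')
         - p ^+ #|edges F| * #|U|%:R ^+ 2 * #|U'|%:R |
        <= delta / 2 * #|G n|%:R ^+ 3 by near: n.
set m : R := #|G n|%:R in n30 Pn.
have m0 : 0 < m by rewrite ltr0n (leq_ltn_trans _ Nn).
(* The prescribed sizes as natural numbers, within [1] of the exact means, which is the slack that
   [disc_of_local_counts] grants. *)
have floorE (c : R) : 0 < c -> exists a : nat,
    [/\ a%:Z = Num.floor (c * m), a%:R <= c * m & `|c * m - a%:R| <= 1].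
  move=> c0; exists `|Num.floor (c * m)|%N.
  have aE : `|Num.floor (c * m)|%N%:Z = Num.floor (c * m).
    by rewrite gez0_abs // floor_ge_int mulr_ge0 // ltW.
  have aR : (`|Num.floor (c * m)|%N%:R : R) = (Num.floor (c * m))%:~R.
    by rewrite -[in RHS]aE.
  have /andP[f1 f2] := floor_itv (c * m).
  rewrite aR; split=> //; move: f2; rewrite intrD => f2.
  by rewrite ger0_norm; lra.
have [a [aE a_le a1]] := floorE _ alpha0.
have [b [bE b_le b1]] := floorE _ beta0.
apply: (loc _ _ a b) => //; first exact: adj_sym.
- rewrite -(ler_nat R) natrD -/m; apply: le_trans (lerD a_le b_le) _.
  by rewrite -mulrDl ler_piMl ?(ltW m0) ?(ltW ab1).
- move=> U U' dU cU cU'.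
  have h1 := defect_avg_le U U'.
  have h2 := Pn U U' dU; rewrite cU cU' -/e in h2; have {}h2 := h2 aE bE.
  rewrite cU cU' -/m in h1; rewrite -/m.
  set D := tri _ _ _ _ in h1 *.
  set V := avg_nhom3 _ _ _ - _ in h1 h2.
  have -> : D = (D - V) + V by rewrite subrK.
  apply: le_trans (norm_add_le h1 h2) _.
  have : 3 * m ^+ 2 <= delta / 2 * m ^+ 3.
    have -> : 3 * m ^+ 2 = 3 / m * m ^+ 3 by field; rewrite gt_eqF.
    by rewrite ler_wpM2r // exprn_ge0 // ltW.
  lra.
Unshelve. all: by end_near. Qed.

Lemma nhom3_disc_le (H : sgraph) (eps : R) (W : 'I_3 -> {set H}) :
  (0 < #|H|)%N -> disc (@adj H) p eps ->
  `|(nhom3 v W)%:R - p ^+ e * \prod_i #|W i|%:R| <=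
  (e%:R * eps + 9 / #|H|%:R) * #|H|%:R ^+ 3.
Proof.
move=> H0 Hdisc; have [g vK gK] := label_bij hF hv.
have p01 : 0 <= p <= 1 by rewrite ltW.
have := hom_count_le (fun u => W (g u)) H0 p01 Hdisc.
rewrite -/e hF -natrX.
have -> : \prod_(u : F) #|W (g u)|%:R = \prod_i #|W i|%:R :> R.
  rewrite (reindex v) /=; last exact: onW_bij (label_bij hF hv).
  by apply: eq_bigr => i _; rewrite vK.
congr (`|_%:R - _| <= _); apply: eq_card => f; rewrite !inE; congr (_ && _).
apply/forallP/forallP => [h i|h u]; first by have := h (v i); rewrite vK.
by have := h (g u); rewrite gK.
Qed.

(** Each of the six labelled counts satisfies the estimate by itself, since the product of the three
    sizes is invariant under permutation; the average inherits it. *)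
Lemma disc_P21 :
  (forall eps : R, 0 < eps -> \forall n \near \oo, disc (@adj (G n)) p eps) ->
  P21 v alpha beta p G.
Proof.
move=> Gdisc eps eps0.
have e10 : 0 < e%:R + 1 :> R by rewrite ltr_pwDr.
near=> n => U U' _ _ _.
have G0 : (0 < #|G n|)%N by near: n; exact: order_near.
have dn : disc (@adj (G n)) p (eps / 2 / (e%:R + 1)).
  by near: n; apply: Gdisc; rewrite !divr_gt0.
have sn : 9 / #|G n|%:R <= eps / 2 by near: n; apply: order_near_inv; rewrite ?divr_gt0.
set t := triple U U U'.
have bound (s : 'S_3) : `|(nhom3 v (fun i => t (s i)))%:R -
    p ^+ e * #|U|%:R ^+ 2 * #|U'|%:R| <= eps * #|G n|%:R ^+ 3.
  have := nhom3_disc_le (fun i => t (s i)) G0 dn.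
  have -> : \prod_i #|t (s i)|%:R = #|U|%:R ^+ 2 * #|U'|%:R :> R.
    rewrite -(reindex_inj (@perm_inj _ s) (P := xpredT) (F := fun i => #|t i|%:R)).
    rewrite (bigD1 i0) // (bigD1 i1) // (bigD1 i2) // big1 /= => [|i].
      by rewrite /t !tripleE mulr1 mulrA expr2.
    by elim/I3_ind: i.
  rewrite mulrA => h; apply: (le_trans h).
  rewrite ler_wpM2r ?exprn_ge0 //.
  have : e%:R * (eps / 2 / (e%:R + 1)) <= eps / 2.
    rewrite mulrA ler_pdivrMr // mulrC ler_pM2l ?divr_gt0 //; lra.
  lra.
rewrite -/e; set c := p ^+ e * _ * _.
have -> : avg_nhom3 R v t - c =
    6^-1 * \sum_(s : 'S_3) ((nhom3 v (fun i => t (s i)))%:R - c).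
  rewrite sumrB sumr_const card_Sn mulrBr /avg_nhom3; congr (_ - _).
  by rewrite -[c *+ _]mulr_natl mulrA mulVf ?mul1r.
rewrite normrM ger0_norm //.
have h : `|\sum_(s : 'S_3) ((nhom3 v (fun i => t (s i)))%:R - c)| <=
    6 * (eps * #|G n|%:R ^+ 3).
  apply: le_trans (ler_norm_sum _ _ _) _.
  apply: le_trans (ler_sum _ (fun s _ => bound s)) _.
  by rewrite sumr_const card_Sn mulr_natl.
lra.
Unshelve. all: by end_near. Qed.

End Equivalence.

Theorem theorem9p3 (R : realType) (F : sgraph) (hF : #|F| = 3%N)
  (eF : (0 < #|edges F|)%N) (v : 'I_3 -> F) (hv : injective v)
  (alpha beta p : R) (halpha : 0 < alpha) (hbeta : 0 < beta)
  (hab : alpha + beta < 1) (hp0 : 0 < p) (hp1 : p <= 1) :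
  quasi_random_property p (P21 v alpha beta p).
Proof.
have p01 : 0 <= p <= 1 by rewrite ltW.
move=> G Ginf; split=> [P|qr].
  apply: (quasi_random_of_disc Ginf p01).
  exact: (P21_disc hF eF hv halpha hbeta hab hp0 hp1 Ginf P).
by apply: disc_P21 => // eps eps0; exact: disc_of_quasi_random.
Qed.
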